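(* Let $k\ge 2$ be a fixed integer and let $f$ be a function in the class $\mathcal{A}_r$, where $r\ge 0$ is real. Let $\theta_k\ge 1/2$ be any real number such that for every $\varepsilon>0$ $$\sum_{n\le x}\tau_k(n)=x\,P_{k-1}(\log x)+O(x^{\theta_k+\varepsilon}).$$ Then for every $\varepsilon>0$, $$\sum_{n_1\cdots n_k\le x}f([n_1,\ldots,n_k])=x^{r+1}Q_{f,k-1}(\log x)+O\big(x^{r+\theta_k+\varepsilon}\big),$$ where the sum is over all $(n_1,\ldots,n_k)\in\mathbb{N}^k$ with $n_1\cdots n_k\le x$, and $Q_{f,k-1}(t)$ is a polynomial in $t$ of degree $k-1$ with leading coefficient $\frac{1}{(r+1)(k-1)!}C_{f,k}$, the constant $C_{f,k}$ being given by $$C_{f,k}=\prod_p\left(1-\frac1p\right)^k\sum_{\nu_1,\ldots,\nu_k=0}^{\infty}\frac{f(p^{\max(\nu_1,\ldots,\nu_k)})}{p^{(r+1)(\nu_1+\cdots+\nu_k)}},$$ with the product taken over all primes $p$.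
   Context: $\mathbb{N}=\{1,2,\ldots\}$; $[n_1,\ldots,n_k]$ denotes the least common multiple of $n_1,\ldots,n_k$. For a fixed real number $r$, $\mathcal{A}_r$ denotes the class of multiplicative arithmetic functions $f:\mathbb{N}\to\mathbb{C}$ for which there exist real constants $C_1,C_2$ such that $|f(p)-p^r|\le C_1\,p^{r-1/2}$ for every prime $p$, and $|f(p^\nu)|\le C_2\,p^{\nu r}$ for every prime power $p^\nu$ with $\nu\ge 2$. $\tau_k$ is the $k$-factor Piltz divisor function: $\tau_k(n)$ is the number of $(n_1,\ldots,n_k)\in\mathbb{N}^k$ with $n_1\cdots n_k=n$. $P_{k-1}$ is the polynomial of degree $k-1$, with leading coefficient $1/(k-1)!$, determined by $P_{k-1}(\log x)=\operatorname{Res}_{s=1}\left(\zeta^k(s)\frac{x^{s-1}}{s}\right)$, where $\zeta$ is the Riemann zeta function.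
   Formalization: Since C_{f,k} can vanish (one Euler factor may be 0), ''Q of degree k-1 with leading coefficient C_{f,k}/((r+1)(k-1)!)'' is stated as: Q has degree at most k-1 and its coefficient of t^{k-1} is that number; if C_{f,k} is nonzero this is the original claim. *)

(* Defs.v *)
From mathcomp Require Export all_boot all_order all_algebra.
From mathcomp Require Export all_classical all_reals all_analysis.
From mathcomp Require Export summability complex.

Set Implicit Arguments.
Unset Strict Implicit.
Unset Printing Implicit Defensive.

Export Order.TTheory GRing.Theory Num.Theory numFieldNormedType.Exports.
#[global] Open Scope classical_set_scope.
#[global] Open Scope ring_scope.
#[global] Open Scope complex_scope.

(* The topology, norm and complex derivative of R[i] are those of R[i]^o, the
   one-dimensional normed module over the field R[i]; hence the casts below. *)
Definition ccvg (R : realType) (u : nat -> R[i]) (l : R[i]) : Prop :=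
  (fun n => u n : R[i]^o) @ \oo --> (l : R[i]^o).

Definition cseries_to (R : realType) (u : nat -> R[i]) (l : R[i]) : Prop :=
  ccvg (fun N => \sum_(0 <= n < N) u n) l.

(* Sum of a family indexed by an arbitrary type: limit of the sums over finite
   subfamilies, along the directed set of finite subsets.  In R[i] this is the
   same as absolute convergence with sum l. *)
Definition csum_to (R : realType) (I : choiceType) (u : I -> R[i]) (l : R[i]) :
    Prop :=
  partial_sum (u : I -> R[i]^o) @ totally --> (l : R[i]^o).

(* x ^ s = exp (s ln x); meant for x > 0. *)
Definition cpow (R : realType) (x : R) (s : R[i]) : R[i] :=
  (expR (complex.Re s * ln x))%:C
    * (cos (complex.Im s * ln x) +i* sin (complex.Im s * ln x)).

(* The analytic continuation to C \ {1} of \sum_(n >= 1) n ^ (- s), Re s > 1;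
   this determines Z away from 1. *)
Definition is_riemann_zeta (R : realType) (Z : R[i] -> R[i]) : Prop :=
  (forall s : R[i], 1 < complex.Re s ->
     cseries_to (fun n => cpow n.+1%:R (- s)) (Z s)) /\
  (forall s : R[i], s != 1 -> derivable (Z : R[i]^o -> R[i]^o) s 1).

(* c is the coefficient of (s - a)^-1 in the Laurent expansion of g on a
   punctured disc around a. *)
Definition is_residue (R : realType) (g : R[i] -> R[i]) (a c : R[i]) : Prop :=
  exists (u v : nat -> R[i]) (delta : R),
    [/\ 0 < delta, v 0%N = c &
      forall s : R[i], 0 < `|s - a| -> `|s - a| < delta%:C ->
        exists A B : R[i],
          [/\ cseries_to (fun n => u n * (s - a) ^+ n) A,
              cseries_to (fun n => v n * (s - a) ^- n.+1) B &
              g s = A + B]].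

(* P = P_{k-1}.  That P has degree k - 1 and leading coefficient 1 / (k - 1)!
   follows from the residue identity, so it is not required separately. *)
Definition is_piltz_poly (R : realType) (Z : R[i] -> R[i]) (k : nat)
    (P : {poly R}) : Prop :=
  forall x : R, 0 < x ->
    is_residue (fun s => Z s ^+ k * (cpow x (s - 1) / s)) 1 (P.[ln x])%:C.

(* Meant for n >= 1: the factors of n are then positive and at most n, so
   bounding them by n in the index type loses nothing. *)
Definition tau (k n : nat) : nat :=
  #|[set d : {ffun 'I_k -> 'I_n.+1} | (\prod_(i < k) d i)%N == n]|.

Definition tau_sum (R : realType) (k : nat) (x : R) : R :=
  \sum_(1 <= n < (Num.truncn x).+1) (tau k n)%:R.

(* Arithmetic functions live on n >= 1; the value at 0 is irrelevant. *)
Definition multiplicative (R : realType) (f : nat -> R[i]) : Prop :=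
  f 1%N = 1 /\
  forall m n : nat, (0 < m)%N -> (0 < n)%N -> coprime m n ->
    f (m * n)%N = f m * f n.

Definition class_A (R : realType) (r : R) (f : nat -> R[i]) : Prop :=
  multiplicative f /\
  exists C1 C2 : R,
    (forall p : nat, prime p ->
       `|f p - (p%:R `^ r)%:C| <= (C1 * p%:R `^ (r - 1 / 2))%:C) /\
    (forall p nu : nat, prime p -> (2 <= nu)%N ->
       `|f (p ^ nu)%N| <= (C2 * p%:R `^ (nu%:R * r))%:C).

(* Positive integers with product at most x are all at most x, so bounding
   them by the integer part of x in the index type loses nothing. *)
Definition lcm_sum (R : realType) (f : nat -> R[i]) (k : nat) (x : R) : R[i] :=
  \sum_(n : {ffun 'I_k -> 'I_(Num.truncn x).+1}
         | [forall i, (0 < n i)%N] && ((\prod_(i < k) n i)%N%:R <= x))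
     f (\big[lcmn/1%N]_(i < k) n i).

Definition euler_term (R : realType) (f : nat -> R[i]) (r : R) (k p : nat)
    (nu : {ffun 'I_k -> nat}) : R[i] :=
  f (p ^ \max_(i < k) nu i)%N
    / (p%:R `^ ((r + 1) * (\sum_(i < k) nu i)%N%:R))%:C.

(* C = C_{f,k}: the multiple series E p converges for each prime p, and the
   product over the primes p < N tends to C as N goes to infinity. *)
Definition is_euler_const (R : realType) (f : nat -> R[i]) (r : R) (k : nat)
    (C : R[i]) : Prop :=
  exists E : nat -> R[i],
    (forall p : nat, prime p -> csum_to (@euler_term R f r k p) (E p)) /\
    ccvg (fun N => \prod_(0 <= p < N | prime p)
                     ((1 - p%:R^-1) ^+ k * E p)) C.

(* Main.v *)
(* Writing F(n) for the sum of f([n_1,...,n_k]) over n_1...n_k = n, the function F is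
   multiplicative and F = g * (tau_k id^r), the Dirichlet convolution with a multiplicative
   g satisfying g(p) = k (f(p) - p^r) = O(p^(r-1/2)) and g(p^v) = O((6/5)^v p^(vr)).  A finite
   Euler product over smooth numbers then bounds the sum of |g(d)| d^(-s) for s > r + 1/2.
   Partial summation gives
     sum_(m <= y) tau_k(m) m^r = y^(r+1) B(ln y) + O(y^(r+theta+eps)),
   where (r+1) B + B' = P + P', and summing over d produces
     Q(t) = sum_d g(d) d^(-(r+1)) B(t - ln d);
   its leading coefficient contains sum_d g(d) d^(-(r+1)), whose Euler product is C.

   The zeta function is not needed: if some theta < 1 is admissible, the error bound itself
   determines the leading term of P from the elementary asymptotics of the sum of tau_k. *)
Require Import Defs.
From mathcomp Require Import zify ring lra finmap.
From mathcomp Require polyrcf.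

Set Implicit Arguments.
Unset Strict Implicit.
Unset Printing Implicit Defensive.

(** * Divisor sums *)

(** Dividing the Dirichlet series of F by zeta(s - r)^k, one factor at a time, is a local operation:
    each division turns h(p^(v+1)) into h(p^(v+1)) - p^r h(p^v). So g is built on prime powers only,
    and the convolution identity is recovered from multiplicativity. The number of exponent tuples
    of sum v, polynomial in v, is absorbed into (6/5)^v. The base has to stay below sqrt 2, because
    the local series of g must converge at p = 2 for every s > r + 1/2; here (6/5) 2^(-1/2) < 6/7.
    Absolute convergence to the left of r + 1 is used three times: for the sum of the errors
    (x/d)^(r+theta+eps), for the tail d > x of the series defining Q, and for the moments of ln d
    that make up the coefficients of Q. C and Q must be fixed before theta. Hence P is first
    replaced by a polynomial [A] with the right leading term, chosen according to whether some theta
    < 1 is admissible, and B is computed from [A]. The estimates are made uniform in x >= 1, since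
    they are applied at points x/d that come close to 1. *)

Definition mult_fun (A : comNzRingType) (h : nat -> A) : Prop :=
  h 1%N = 1 /\
  forall m n : nat, (0 < m)%N -> (0 < n)%N -> coprime m n ->
    h (m * n)%N = h m * h n.

Section DivisorSums.
Variable V : nmodType.
Implicit Types (G : nat -> V) (X : nat -> nat -> V).

Lemma big_divisorsE n N G : (0 < n <= N)%N ->
  \sum_(d <- divisors n) G d = \sum_(1 <= d < N.+1 | (d %| n)%N) G d.
Proof.
case/andP=> n0 nN; rewrite -[RHS]big_filter; apply: perm_big.
apply: uniq_perm; rewrite ?divisors_uniq ?filter_uniq ?iota_uniq //.
move=> d; rewrite -dvdn_divisors // mem_filter mem_index_iota ltnS.
case dn: (d %| n)%N => //=.
by rewrite (dvdn_gt0 n0 dn) (leq_trans (dvdn_leq n0 dn) nN).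
Qed.

(** The map (d, e) -> d e is inverted by n -> (gcd(n, a), gcd(n, b)), because a and b are
    coprime. *)
Lemma big_divisorsM a b G : (0 < a)%N -> (0 < b)%N -> coprime a b ->
  \sum_(d <- divisors (a * b)) G d
  = \sum_(d <- divisors a) \sum_(e <- divisors b) G (d * e)%N.
Proof.
move=> a0 b0 cab.
transitivity (\sum_(d <- [seq (d * e)%N | d <- divisors a, e <- divisors b]) G d);
  last by rewrite big_allpairs_dep.
have gcdK d e : (d %| a)%N -> (e %| b)%N -> gcdn (d * e) a = d /\ gcdn (d * e) b = e.
  move=> da eb; split.
    rewrite gcdnC mulnC Gauss_gcdr ?(gcdn_idPr da) //.
    exact: coprime_dvdr eb cab.
  rewrite gcdnC Gauss_gcdr ?(gcdn_idPr eb) //.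
  by rewrite coprime_sym; exact: coprime_dvdl da cab.
apply: perm_big; apply: uniq_perm; rewrite ?divisors_uniq //.
  apply: allpairs_uniq; rewrite ?divisors_uniq // => -[d e] [d' e'] /=.
  move=> /allpairsP[[u v] /= [ud vd [-> ->]]] /allpairsP[[u' v'] /= [ud' vd' [-> ->]]] eq.
  rewrite -!dvdn_divisors // in ud vd ud' vd'.
  have [h1 h2] := gcdK _ _ ud vd; have [h3 h4] := gcdK _ _ ud' vd'.
  by congr (_, _); [rewrite -h1 eq h3 | rewrite -h2 eq h4].
move=> n; rewrite -dvdn_divisors ?muln_gt0 ?a0 //; apply/idP/allpairsP => /=.
  move=> nab; exists (gcdn n a, gcdn n b) => /=; rewrite -!dvdn_divisors //.
  split; rewrite ?dvdn_gcdr //.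
  apply/eqP; rewrite eqn_dvd; apply/andP; split.
    have nn := dvdnn n.
    by rewrite muln_gcdr !muln_gcdl !dvdn_gcd nab !(dvdn_mulr _ nn) !(dvdn_mull _ nn).
  rewrite Gauss_dvd ?dvdn_gcdl //.
  by apply: coprime_dvdl (dvdn_gcdr _ _) (coprime_dvdr (dvdn_gcdr _ _) cab).
case=> -[d e] /= []; rewrite -!dvdn_divisors // => da eb ->.
exact: dvdn_mul.
Qed.

Lemma big_divisors_pfactor p n G : prime p ->
  \sum_(d <- divisors (p ^ n)) G d = \sum_(i < n.+1) G (p ^ i)%N.
Proof.
move=> pp; have p0 := prime_gt0 pp; have p1 := prime_gt1 pp.
rewrite -(big_mkord predT (fun i => G (p ^ i)%N)) /index_iota subn0.
rewrite -(big_map (fun i => p ^ i)%N predT G); apply: perm_big.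
apply: uniq_perm; rewrite ?divisors_uniq ?map_inj_uniq ?iota_uniq //.
  by move=> i j /eqP; rewrite eqn_exp2l // => /eqP.
move=> d; rewrite -dvdn_divisors ?expn_gt0 ?p0 //.
apply/(dvdn_pfactor _ _ pp)/mapP => -[m hm ->]; exists m => //.
  by rewrite mem_iota ltnS.
by move: hm; rewrite mem_iota ltnS.
Qed.

(** Both sides run over the pairs (d, e) with d e dividing n. *)
Lemma exchange_big_divisors n X : (0 < n)%N ->
  \sum_(d <- divisors n) \sum_(e <- divisors (n %/ d)) X d e
  = \sum_(e <- divisors n) \sum_(d <- divisors (n %/ e)) X d e.
Proof.
move=> n0.
have E (Y : nat -> nat -> V) : \sum_(d <- divisors n) \sum_(e <- divisors (n %/ d)) Y d e
  = \sum_(1 <= d < n.+1) \sum_(1 <= e < n.+1 | (d * e %| n)%N) Y d e.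
  rewrite (@big_divisorsE n n (fun d => \sum_(e <- divisors (n %/ d)) Y d e)) ?n0 ?leqnn //.
  rewrite big_mkcond /=.
  apply: eq_big_nat => d /andP[d0 _].
  case dn: (d %| n)%N; last first.
    rewrite big1 // => e den; move: dn.
    by rewrite (dvdn_trans (dvdn_mulr _ (dvdnn d)) den).
  rewrite (@big_divisorsE _ n (Y d)); first by apply: eq_bigl => e; rewrite dvdn_divRL // mulnC.
  by rewrite divn_gt0 // (dvdn_leq n0 dn) leq_div.
rewrite E (E (fun e d => X d e)) (exchange_big_dep predT) //=.
apply: eq_bigr => e _; apply: eq_bigl => d.
by rewrite mulnC.
Qed.

Lemma sum_big_divisors N X :
  \sum_(1 <= n < N.+1) \sum_(d <- divisors n) X d (n %/ d)%N
  = \sum_(1 <= d < N.+1) \sum_(1 <= m < (N %/ d).+1) X d m.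
Proof.
transitivity (\sum_(1 <= n < N.+1) \sum_(1 <= d < N.+1 | (d %| n)%N) X d (n %/ d)%N).
  by apply: eq_big_nat => n hn; exact: big_divisorsE.
rewrite (exchange_big_dep predT) //=; apply: eq_big_nat => d /andP[d0 _].
(* For fixed d, passing from N to N + 1 raises the quotient by d exactly when d divides N + 1, which
   is also when the left side gains a term. *)
elim: N => [|N IH]; first by rewrite div0n !big_geq.
rewrite big_mkcond big_nat_recr //= -big_mkcond /= IH divnS //.
case: ifP => dN; last by rewrite addr0.
rewrite [in RHS]add1n [in RHS]big_nat_recr //=; congr (_ + X d _).
by rewrite dN.
Qed.
End DivisorSums.

Lemma divn_mulM m n d e : (0 < d)%N -> (0 < e)%N -> (d %| m)%N -> (e %| n)%N ->
  ((m * n) %/ (d * e) = (m %/ d) * (n %/ e))%N.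
Proof.
move=> d0 e0 dm en; apply/eqP; rewrite eq_sym eqn_div ?muln_gt0 ?d0 ?dvdn_mul //.
by rewrite mulnACA !divnK.
Qed.

(** * Sums over tuples, split into first entry and remaining entries *)

Section FinfunCons.
Variables (N : nat) (V : nmodType).

Definition fcons k (i : 'I_N) (t : {ffun 'I_k -> 'I_N}) : {ffun 'I_k.+1 -> 'I_N} :=
  [ffun j => oapp t i (unlift ord0 j)].

Lemma fcons0 k i (t : {ffun 'I_k -> 'I_N}) : fcons i t ord0 = i.
Proof. by rewrite ffunE unlift_none. Qed.

Lemma fconsS k i (t : {ffun 'I_k -> 'I_N}) j : fcons i t (lift ord0 j) = t j.
Proof. by rewrite ffunE liftK. Qed.

Lemma sum_fcons k (Q : pred {ffun 'I_k.+1 -> 'I_N}) (G : {ffun 'I_k.+1 -> 'I_N} -> V) :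
  \sum_(t | Q t) G t = \sum_(i < N) \sum_(t | Q (fcons i t)) G (fcons i t).
Proof.
rewrite pair_big_dep /=.
rewrite (reindex (fun u : 'I_N * {ffun 'I_k -> 'I_N} => fcons u.1 u.2)) //=.
exists (fun t : {ffun 'I_k.+1 -> 'I_N} => (t ord0, [ffun j => t (lift ord0 j)])).
  move=> [i t] _ /=; congr (_, _); first by rewrite fcons0.
  by apply/ffunP => j; rewrite ffunE fconsS.
move=> t _ /=; apply/ffunP => j; rewrite ffunE.
by case: unliftP => [j' ->|->] /=; rewrite ?ffunE.
Qed.

Lemma sum_ffun0 (Q : pred {ffun 'I_0 -> 'I_N}) (G : {ffun 'I_0 -> 'I_N} -> V) t0 :
  \sum_(t | Q t) G t = if Q t0 then G t0 else 0.
Proof.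
have E t : t = t0 by apply/ffunP => -[].
rewrite (eq_bigl (fun t => (t == t0) && Q t)); last by move=> t; rewrite (E t) eqxx.
by rewrite big_mkcondr big_pred1_eq.
Qed.
End FinfunCons.

(** * The sums of f([n_1,...,n_k]) over factorizations of n *)

Section LcmConv.
Variables (A : comNzRingType).
Implicit Type f : nat -> A.

(** Sum of f([c, n_1, ..., n_k]) over n_1...n_k = n. The accumulator [c] holds the lcm of the
    entries already chosen, which is what makes a recursion on [k] possible; F is the case c = 1. *)
Fixpoint lcm_conv f (k c n : nat) : A :=
  if k is k'.+1 then \sum_(d <- divisors n) lcm_conv f k' (lcmn c d) (n %/ d)
  else if n == 1%N then f c else 0.

Lemma lcm_convE f k N c n : (0 < n <= N)%N ->
  \sum_(t : {ffun 'I_k -> 'I_N.+1} | (\prod_(i < k) t i)%N == n)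
     f (lcmn c (\big[lcmn/1%N]_(i < k) t i)) = lcm_conv f k c n.
Proof.
elim: k c n => [|k IH] c n /andP[n0 nN].
  by rewrite (sum_ffun0 _ _ [ffun=> ord0]) !big_ord0 lcmn1 /= eq_sym.
rewrite sum_fcons /= (@big_divisorsE _ n N) ?n0 // big_add1 big_mkord big_mkcond /=.
(* The index type also contains the entry 0; it contributes nothing because the product n is
   positive. *)
rewrite big_ord_recl /= big1 ?add0r; last first.
  move=> t; rewrite big_ord_recl fcons0 /= mul0n => /eqP e.
  by rewrite -e in n0.
rewrite [RHS]big_mkcond; apply: eq_bigr => i _ /=.
case: ifP => [dn|ndn]; last first.
  rewrite big1 // => t; rewrite big_ord_recl fcons0 lift0 /= => /eqP e.
  by rewrite -e dvdn_mulr in ndn.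
rewrite -IH; last first.
  rewrite divn_gt0 // (dvdn_leq n0 dn) /=; exact: leq_trans (leq_div _ _) nN.
apply: eq_big => t.
  rewrite big_ord_recl fcons0 lift0 /= eqn_div // mulnC.
  by congr (_ == _); congr (_ * _)%N; apply: eq_bigr => j _; rewrite fconsS.
move=> _; rewrite big_ord_recl fcons0 lcmnA lift0 /=; congr (f (lcmn _ _)).
by apply: eq_bigr => j _; rewrite fconsS.
Qed.

(** On powers of p, products become sums of exponents and lcms become maxima, which is the shape of
    the local series in C. *)
Lemma lcm_conv_pfactor f k V p c j : prime p -> (j < V)%N ->
  \sum_(t : {ffun 'I_k -> 'I_V} | (\sum_(i < k) t i)%N == j)
     f (p ^ maxn c (\max_(i < k) t i))%N = lcm_conv f k (p ^ c) (p ^ j).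
Proof.
move=> pp; have p1 := prime_gt1 pp.
elim: k c j => [|k IH] c j jV.
  rewrite (sum_ffun0 _ _ [ffun=> Ordinal jV]) !big_ord0 maxn0 /=.
  by rewrite -[X in _ = if _ == X then _ else _](expn0 p) eqn_exp2l // eq_sym.
rewrite sum_fcons /= big_divisors_pfactor //.
rewrite (big_ord_widen V (fun i => lcm_conv f k (lcmn (p ^ c) (p ^ i)) (p ^ j %/ p ^ i))) //.
rewrite [RHS]big_mkcond; apply: eq_bigr => i _ /=.
case: ifP => [|/negbT]; rewrite ltnS => ij; last first.
  rewrite big1 // => t; rewrite big_ord_recl fcons0 /= => /eqP e.
  by rewrite -e leq_addr in ij.
rewrite -expnB // ?(ltnW p1) //.
rewrite -expn_max -IH; last exact: leq_ltn_trans (leq_subr _ _) jV.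
apply: eq_big => t.
  rewrite big_ord_recl fcons0 /= -[RHS](eqn_add2l i) subnKC //.
  by congr (_ == _); congr (_ + _)%N; apply: eq_bigr => l _; rewrite fconsS.
move=> _; rewrite big_ord_recl fcons0 maxnA; congr (f (p ^ maxn _ _)%N).
by apply: eq_bigr => l _; rewrite fconsS.
Qed.

(** Coprimality is asked of n c and n' c', not only of n and n': the accumulators absorb divisors of
    n and n', and the induction needs the two sides to stay coprime afterwards. *)
Lemma lcm_convM f k c c' n n' : mult_fun f ->
  (0 < c)%N -> (0 < c')%N -> (0 < n)%N -> (0 < n')%N ->
  coprime (n * c) (n' * c') ->
  lcm_conv f k (c * c') (n * n') = lcm_conv f k c n * lcm_conv f k c' n'.
Proof.
move=> [f1 fM]; elim: k c c' n n' => [|k IH] c c' n n' c0 c'0 n0 n'0.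
  rewrite /= muln_eq1 coprimeMl !coprimeMr => /andP[/andP[nn' nc'] /andP[cn' cc']].
  case: eqP => [_|_]; last by rewrite mul0r.
  by case: eqP => [_|_]; rewrite ?mulr0 //= fM.
move=> cop; have := cop.
rewrite coprimeMl !coprimeMr => /andP[/andP[nn' nc'] /andP[cn' cc']].
rewrite /= big_divisorsM // big_distrl /=.
rewrite big_seq [RHS]big_seq; apply: eq_bigr => d; rewrite -dvdn_divisors // => dn.
rewrite big_distrr /= big_seq [RHS]big_seq; apply: eq_bigr => e.
rewrite -dvdn_divisors // => en.
have d0 := dvdn_gt0 n0 dn; have e0 := dvdn_gt0 n'0 en.
have -> : lcmn (c * c') (d * e) = (lcmn c d * lcmn c' e)%N.
  have c1 : coprime (lcmn c d) (lcmn c' e).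
    have h : (lcmn c d %| n * c)%N by rewrite dvdn_lcm dvdn_mull // dvdn_mulr.
    have h' : (lcmn c' e %| n' * c')%N by rewrite dvdn_lcm dvdn_mull // dvdn_mulr.
    exact: coprime_dvdl h (coprime_dvdr h' cop).
  apply/eqP; rewrite eqn_dvd; apply/andP; split.
    by rewrite dvdn_lcm !dvdn_mul // ?dvdn_lcml ?dvdn_lcmr.
  rewrite Gauss_dvd // !dvdn_lcm.
  rewrite (dvdn_trans (dvdn_mulr c' (dvdnn c))) ?dvdn_lcml //.
  rewrite (dvdn_trans (dvdn_mulr e (dvdnn d))) ?dvdn_lcmr //.
  rewrite (dvdn_trans (dvdn_mull c (dvdnn c'))) ?dvdn_lcml //.
  by rewrite (dvdn_trans (dvdn_mull d (dvdnn e))) ?dvdn_lcmr.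
rewrite divn_mulM //; apply: IH; rewrite ?lcmn_gt0 ?c0 ?c'0 ?divn_gt0 ?(dvdn_leq n0 dn) ?(dvdn_leq n'0 en) //.
(* After a divisor l has moved from m into the accumulator, the new product still divides the old
   one, so coprimality is inherited. *)
have h m b l : (l %| m)%N -> ((m %/ l) * lcmn b l %| m * b)%N.
  move=> lm; rewrite -{2}(divnK lm) -mulnA dvdn_mul //.
  by rewrite dvdn_lcm dvdn_mull // dvdn_mulr.
exact: coprime_dvdl (h _ _ _ dn) (coprime_dvdr (h _ _ _ en) cop).
Qed.

(** For constant f the accumulator is irrelevant, and the recursion is the usual tau_(k+1) = 1 *
    tau_k. *)
Lemma lcm_conv1 k c n : (0 < n)%N ->
  lcm_conv (fun=> 1) k.+1 c n = \sum_(d <- divisors n) lcm_conv (fun=> 1) k 1 (n %/ d).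
Proof.
have E m c1 c2 i : lcm_conv (fun=> 1) m c1 i = lcm_conv (fun=> 1) m c2 i.
  elim: m c1 c2 i => // m IH c1 c2 i /=; apply: eq_bigr => d _; exact: IH.
by move=> n0 /=; apply: eq_bigr => d _; exact: E.
Qed.

Lemma tau_lcm_conv k n : (0 < n)%N -> (tau k n)%:R = lcm_conv (fun=> 1) k 1 n.
Proof.
move=> n0; rewrite -(@lcm_convE _ k n) ?n0 ?leqnn // sumr_const /tau.
congr (_%:R); apply: eq_card => t; exact: asboolb.
Qed.
End LcmConv.

(** * Multiplicative functions and smooth numbers *)

Section Multiplicative.
Variable A : comNzRingType.
Implicit Types (h : nat -> A) (g : nat -> nat -> A).

(** Strong induction: the full power of the least prime factor is split off, leaving a smaller
    coprime cofactor. *)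
Lemma mult_fun_eq h1 h2 : mult_fun h1 -> mult_fun h2 ->
  (forall p v, prime p -> h1 (p ^ v)%N = h2 (p ^ v)%N) ->
  forall n, (0 < n)%N -> h1 n = h2 n.
Proof.
move=> [h11 h1M] [h21 h2M] E n; elim/ltn_ind: n => n IH n0.
case: (ltngtP n 1) => [|n1|->]; [by rewrite ltnNge n0| |by rewrite h11 h21].
have pp := pdiv_prime n1; set p := pdiv n in pp.
have [m cpm nE] := pfactor_coprime pp n0.
have l0 : (0 < logn p n)%N by rewrite logn_gt0 mem_primes pp n0 pdiv_dvd.
have m0 : (0 < m)%N by move: n0; rewrite nE muln_gt0 => /andP[].
have pl0 : (0 < p ^ logn p n)%N by rewrite expn_gt0 prime_gt0.
have cop : coprime m (p ^ logn p n) by rewrite coprime_sym coprimeXl.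
rewrite nE h1M // h2M // E // IH // {1}nE.
by rewrite ltn_Pmulr // -(exp1n (logn p n)) ltn_exp2r // prime_gt1.
Qed.

Definition prime_ext g n : A := \prod_(p <- primes n) g p (logn p n).

Lemma prime_ext_mult g : (forall p, g p 0%N = 1) -> mult_fun (prime_ext g).
Proof.
move=> g0; split=> [|m n m0 n0 cop]; first by rewrite /prime_ext big_nil.
rewrite /prime_ext.
have -> : \prod_(p <- primes (m * n)) g p (logn p (m * n))
   = \prod_(p <- primes m ++ primes n) g p (logn p (m * n)).
  apply: perm_big; apply: uniq_perm; rewrite ?primes_uniq //.
    rewrite cat_uniq !primes_uniq andbT /= -coprime_has_primes //.
  by move=> p; rewrite mem_cat primesM.
have lM p a b : (0 < a)%N -> (0 < b)%N -> coprime a b -> p \in primes a ->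
    logn p (a * b) = logn p a.
  move=> a0 b0 ab; rewrite mem_primes => /and3P[pp _ pa].
  rewrite lognM // [logn p b]logn_coprime ?addn0 //.
  exact: coprime_dvdl pa ab.
rewrite big_cat; congr (_ * _); rewrite big_seq [RHS]big_seq; apply: eq_bigr => p hp.
  by rewrite lM.
by rewrite mulnC lM // coprime_sym.
Qed.

Lemma prime_extX g p v : (forall p, g p 0%N = 1) -> prime p ->
  prime_ext g (p ^ v)%N = g p v.
Proof.
move=> g0 pp; case: v => [|v]; first by rewrite /prime_ext big_nil g0.
by rewrite /prime_ext primesX // primes_prime // big_seq1 pfactorK.
Qed.

Variable J : nat -> A.
Hypothesis J1 : J 1%N = 1.
Hypothesis JM : forall m n, (0 < m)%N -> (0 < n)%N -> J (m * n)%N = J m * J n.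

(** Dirichlet convolution with the completely multiplicative [J]; for J(n) = n^r it multiplies the
    Dirichlet series by zeta(s - r). *)
Definition twist_sum h n : A := \sum_(d <- divisors n) J d * h (n %/ d)%N.

(** Convolution with mu J, the Dirichlet inverse of [J]. Since mu vanishes on p^2, p^3, ..., only
    two terms survive at a prime power; extending multiplicatively from there avoids mu, and the
    result inverts [twist_sum] on multiplicative functions. *)
Definition twist_inv h : nat -> A :=
  prime_ext (fun p v => if v is v'.+1 then h (p ^ v)%N - J p * h (p ^ v')%N else 1).

Lemma JX p v : prime p -> J (p ^ v)%N = J p ^+ v.
Proof.
move=> pp; elim: v => [|v IH]; first by rewrite expn0 J1.
by rewrite expnS JM ?expn_gt0 ?prime_gt0 // IH exprS.
Qed.

Lemma eq_twist_sum h1 h2 : (forall n, (0 < n)%N -> h1 n = h2 n) ->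
  forall n, (0 < n)%N -> twist_sum h1 n = twist_sum h2 n.
Proof.
move=> E n n0; rewrite /twist_sum big_seq [RHS]big_seq; apply: eq_bigr => d.
rewrite -dvdn_divisors // => dn; rewrite E // divn_gt0 ?(dvdn_gt0 _ dn) //.
exact: dvdn_leq.
Qed.

Lemma twist_sum_mult h : mult_fun h -> mult_fun (twist_sum h).
Proof.
move=> [h1 hM]; split=> [|m n m0 n0 cop].
  by rewrite /twist_sum big_seq1 J1 mul1r h1.
rewrite /twist_sum big_divisorsM // big_distrl /= big_seq [RHS]big_seq.
apply: eq_bigr => d; rewrite -dvdn_divisors // => dm.
rewrite big_distrr /= big_seq [RHS]big_seq; apply: eq_bigr => e.
rewrite -dvdn_divisors // => en.
have d0 := dvdn_gt0 m0 dm; have e0 := dvdn_gt0 n0 en.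
rewrite divn_mulM //.
rewrite JM // hM ?divn_gt0 ?(dvdn_leq m0 dm) ?(dvdn_leq n0 en) //.
  exact: mulrACA.
exact: coprime_dvdl (dvdn_div dm) (coprime_dvdr (dvdn_div en) cop).
Qed.

Lemma twist_sum_pfactor h p v : prime p ->
  twist_sum h (p ^ v)%N = \sum_(i < v.+1) J p ^+ i * h (p ^ (v - i))%N.
Proof.
move=> pp; rewrite /twist_sum big_divisors_pfactor //; apply: eq_bigr => i _.
by rewrite JX // -expnB ?prime_gt0 // -ltnS.
Qed.

Lemma twist_inv_mult h : mult_fun (twist_inv h).
Proof. exact: prime_ext_mult. Qed.

Lemma twist_inv_pfactor h p v : prime p ->
  twist_inv h (p ^ v.+1)%N = h (p ^ v.+1)%N - J p * h (p ^ v)%N.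
Proof. by move=> pp; rewrite /twist_inv prime_extX. Qed.

Lemma twist_sumK h n : mult_fun h -> (0 < n)%N -> twist_sum (twist_inv h) n = h n.
Proof.
move=> hm; move: n; apply: mult_fun_eq => //.
  exact/twist_sum_mult/twist_inv_mult.
move=> p v pp; rewrite twist_sum_pfactor //.
elim: v => [|v IH].
  rewrite big_ord1 expr0 mul1r subnn expn0 (proj1 hm).
  by case: (twist_inv_mult h).
rewrite big_ord_recl expr0 mul1r subn0 twist_inv_pfactor //=.
(* The terms i >= 1 form J(p) times the sum for exponent v, which is J(p) h(p^v) by induction and
   cancels the subtracted term. *)
under eq_bigr => i _ do rewrite /bump /= add1n exprS -mulrA subSS.
by rewrite -big_distrr /= IH subrK.
Qed.

Lemma iter_twist_sumK h k n : mult_fun h -> (0 < n)%N ->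
  iter k twist_sum (iter k twist_inv h) n = h n.
Proof.
elim: k h n => // k IH h n hm n0; rewrite iterS iterSr.
rewrite (@eq_twist_sum _ (twist_inv h)) //; first exact: twist_sumK.
by move=> m m0; apply: IH => //; exact: twist_inv_mult.
Qed.

(** The k-fold convolution power of a completely multiplicative [J] is tau_k J: each factorization
    of m into k parts contributes the same product J(m). *)
Lemma iter_twist_sum_tau h k n : (0 < n)%N ->
  iter k twist_sum h n
  = \sum_(d <- divisors n) h d * ((tau k (n %/ d))%:R * J (n %/ d)%N).
Proof.
elim: k n => [|k IH] n n0.
  rewrite /= big_seq (eq_bigr (fun d => if d == n then h d else 0)); last first.
    move=> d; rewrite -dvdn_divisors // => dn.
    have d0 := dvdn_gt0 n0 dn.
    rewrite tau_lcm_conv ?divn_gt0 ?(dvdn_leq n0 dn) //= -[RHS]mulr1.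
    rewrite -(eqn_pmul2r d0) divnK // mul1n eq_sym.
    by case: eqP => [->|_]; [rewrite divnn n0 J1 !mulr1 | rewrite !mul0r mulr0].
  rewrite -big_seq -big_mkcond /= -big_filter.
  have -> : [seq i <- divisors n | i == n] = [:: n]; last by rewrite big_seq1.
  rewrite filter_pred1_uniq ?divisors_uniq // -dvdn_divisors //.
rewrite iterS (eq_twist_sum IH) // /twist_sum.
under eq_bigr => d _ do rewrite big_distrr /=.
rewrite exchange_big_divisors // big_seq [RHS]big_seq; apply: eq_bigr => e.
rewrite -dvdn_divisors // => en; have e0 := dvdn_gt0 n0 en.
have ne0 : (0 < n %/ e)%N by rewrite divn_gt0 // (dvdn_leq n0 en).
rewrite tau_lcm_conv // lcm_conv1 // big_distrl big_distrr /=.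
rewrite big_seq [RHS]big_seq; apply: eq_bigr => d; rewrite -dvdn_divisors // => de.
have d0 := dvdn_gt0 ne0 de.
have ned0 : (0 < n %/ e %/ d)%N by rewrite divn_gt0 // (dvdn_leq ne0 de).
have -> : (n %/ d %/ e = n %/ e %/ d)%N by rewrite -!divnMA mulnC.
rewrite -tau_lcm_conv //.
have -> : J (n %/ e)%N = J (n %/ e %/ d)%N * J d by rewrite -JM // divnK.
by ring.
Qed.

(** The numbers with all prime factors below [y] and all exponents below [V]. Bounding the exponents
    as well makes the list finite, so that an Euler product expands over it exactly, without any
    convergence. *)
Fixpoint smooth (V y : nat) : seq nat :=
  if y is y'.+1 then
    if prime y' then [seq (m * y' ^ v)%N | m <- smooth V y', v <- iota 0 V]
    else smooth V y'
  else [:: 1%N].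

Lemma smooth_lt V y n : n \in smooth V y ->
  (0 < n)%N /\ forall p, prime p -> (p %| n)%N -> (p < y)%N.
Proof.
elim: y n => [|y IH] n /=.
  rewrite inE => /eqP ->; split=> // p pp; rewrite dvdn1 => /eqP p1.
  by rewrite p1 in pp.
case: ifP => yp; last first.
  by move=> /IH[n0 h]; split=> // p pp pn; apply: ltnW; exact: h.
case/allpairsP => -[m v] /= [/IH[m0 h] _ ->].
split; first by rewrite muln_gt0 m0 expn_gt0 prime_gt0.
move=> p pp; rewrite Euclid_dvdM // => /orP[/(h _ pp)/ltnW //|].
by rewrite Euclid_dvdX // dvdn_prime2 // => /andP[/eqP -> _].
Qed.

Lemma smooth_coprime V y v m : prime y -> m \in smooth V y -> coprime m (y ^ v).
Proof.
move=> yp /smooth_lt[m0 h]; rewrite coprime_sym coprimeXl // prime_coprime //.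
by apply/negP => /(h _ yp); rewrite ltnn.
Qed.

Lemma smooth_uniq V y : uniq (smooth V y).
Proof.
elim: y => //= y IH; case: ifP => yp //; apply: allpairs_uniq => //; first exact: iota_uniq.
move=> -[m v] [m' v'] /allpairsP[[a b] /= [ha _ [-> ->]]] /allpairsP[[a' b'] /= [ha' _ [-> ->]]] E.
have [a0 _] := smooth_lt ha; have [a'0 _] := smooth_lt ha'.
have L c d : c \in smooth V y -> logn y (c * y ^ d)%N = d.
  move=> hc; have [c0 _] := smooth_lt hc.
  have yd0 : (0 < y ^ d)%N by rewrite expn_gt0 prime_gt0.
  rewrite lognM // pfactorK // logn_coprime //.
  by have := smooth_coprime 1 yp hc; rewrite expn1 coprime_sym.
have bb : b = b' by rewrite -(L _ b ha) E L.
rewrite -bb in E *; congr (_, _); apply/eqP.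
by move/eqP: E; rewrite eqn_pmul2r // expn_gt0 prime_gt0.
Qed.

Lemma mem_smooth V y n : (0 < V)%N -> (0 < n)%N ->
  (forall p, prime p -> (p %| n)%N -> (p < y)%N /\ (logn p n < V)%N) ->
  n \in smooth V y.
Proof.
move=> V0; elim: y n => [|y IH] n n0 h.
  case: (ltngtP n 1) => [|n1|->]; [by rewrite ltnNge n0| |by rewrite inE].
  by have [] := h _ (pdiv_prime n1) (pdiv_dvd n).
rewrite /=; case: ifP => yp; last first.
  apply: IH => // p pp pn; have [py pV] := h p pp pn; split=> //.
  by rewrite ltn_neqAle -ltnS py andbT; apply/eqP => e; rewrite -e pp in yp.
have [m cym nE] := pfactor_coprime yp n0.
have m0 : (0 < m)%N by move: n0; rewrite nE muln_gt0 => /andP[].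
have yl0 : (0 < y ^ logn y n)%N by rewrite expn_gt0 prime_gt0.
have mn : (m %| n)%N by rewrite nE dvdn_mulr.
apply/allpairsP; exists (m, logn y n); split => //=.
  apply: IH => // p pp pm; have pn := dvdn_trans pm mn; have [py pV] := h p pp pn; split.
    rewrite ltn_neqAle -ltnS py andbT; apply/eqP => e.
    by move: cym; rewrite -e prime_coprime // pm.
  apply: leq_ltn_trans pV; exact: dvdn_leq_log.
rewrite mem_iota add0n /=; case yn: (y %| n)%N; first by have [] := h y yp yn.
by rewrite lognE yp n0 yn.
Qed.

Lemma prod_sum_smooth h V y : mult_fun h ->
  \prod_(0 <= p < y | prime p) \sum_(0 <= v < V) h (p ^ v)%N
  = \sum_(n <- smooth V y) h n.
Proof.
move=> [h1 hM]; elim: y => [|y IH]; first by rewrite big_geq // big_seq1 h1.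
rewrite big_mkcond big_nat_recr //= -big_mkcond /= {}IH.
case: ifP => yp; last by rewrite mulr1.
rewrite big_allpairs_dep big_distrl /= big_seq [RHS]big_seq; apply: eq_bigr => m hm.
have [m0 _] := smooth_lt hm.
rewrite big_distrr /= /index_iota subn0; apply: eq_bigr => v _.
rewrite hM ?m0 ?expn_gt0 ?prime_gt0 //; exact: (smooth_coprime v yp hm).
Qed.

End Multiplicative.

(** * Complex limits and series *)

Section ComplexNorm.
Variable R : realType.
Implicit Types (z w l : R[i]) (u v : nat -> R[i]).

(** The norm of R[i] takes its values in R[i]; this is the same norm with values in [R], where real
    order reasoning applies. *)
Definition nrm z : R := Normc.normc z.

Lemma normcE z : `|z| = (nrm z)%:C.
Proof. by []. Qed.

Lemma nrm0 : nrm 0 = 0. Proof. exact: Normc.normc0. Qed.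
Lemma nrm1 : nrm 1 = 1. Proof. exact: Normc.normc1. Qed.
Lemma nrmM z w : nrm (z * w) = nrm z * nrm w.
Proof. exact: Normc.normcM. Qed.
Lemma nrmX z n : nrm (z ^+ n) = nrm z ^+ n.
Proof. by elim: n => [|n IH]; rewrite ?expr0 ?nrm1 // !exprS nrmM IH. Qed.
Lemma nrm_ge0 z : 0 <= nrm z.
Proof. rewrite -lecR -normcE; exact: normr_ge0. Qed.
Lemma nrmN z : nrm (- z) = nrm z.
Proof. by apply: (@complexI R); rewrite -!normcE normrN. Qed.
Lemma nrmB z w : nrm (z - w) = nrm (w - z).
Proof. by rewrite -nrmN opprB. Qed.
Lemma ler_nrmD z w : nrm (z + w) <= nrm z + nrm w.
Proof. by rewrite -lecR rmorphD -!normcE ler_normD. Qed.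
Lemma ler_nrmB z w : nrm (z - w) <= nrm z + nrm w.
Proof. by rewrite -(nrmN w) ler_nrmD. Qed.
Lemma ler_nrm_dist z w a : nrm (z - a) <= nrm (z - w) + nrm (w - a).
Proof. by have := ler_nrmD (z - w) (w - a); rewrite addrA subrK. Qed.
Lemma nrmC (x : R) : nrm x%:C = `|x|.
Proof. by rewrite /nrm /= expr0n /= addr0 sqrtr_sqr. Qed.

Lemma ler_nrm_sum (I : Type) (s : seq I) (P : pred I) (F : I -> R[i]) :
  nrm (\sum_(i <- s | P i) F i) <= \sum_(i <- s | P i) nrm (F i).
Proof.
elim/big_rec2: _ => [|i y x _ h]; first by rewrite nrm0.
by apply: le_trans (ler_nrmD _ _) _; rewrite lerD2l.
Qed.

Lemma nrm_geRe z : `|complex.Re z| <= nrm z.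
Proof. by rewrite -lecR -normcE normc_ge_Re. Qed.

Lemma nrm_geIm z : `|complex.Im z| <= nrm z.
Proof.
rewrite /nrm; case: z => a b /=.
by rewrite -sqrtr_sqr ler_wsqrtr // lerDr sqr_ge0.
Qed.

Lemma nrm_le_ReIm z : nrm z <= `|complex.Re z| + `|complex.Im z|.
Proof.
case: z => a b; have -> : a +i* b = a%:C + 'i%C * b%:C.
  by rewrite [LHS]complexE.
apply: le_trans (ler_nrmD _ _) _; rewrite nrmM !nrmC /=.
by rewrite expr0n /= add0r expr1n sqrtr1 mul1r mul0r mulr0 subr0 mul0r mul1r !add0r addr0.
Qed.

Definition tends u l := forall e : R, 0 < e ->
  exists N, forall n, (N <= n)%N -> nrm (u n - l) <= e.

Lemma tends_ccvg u l : tends u l -> ccvg u l.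
Proof.
move=> h; apply/cvgrPdist_le => e e0.
have [N hN] : exists N, forall n, (N <= n)%N -> nrm (u n - l) <= complex.Re e.
  by apply: h; move: e0; rewrite ltcE => /andP[].
exists N => // n /= /hN; rewrite nrmB -lecR -normcE.
(* Being positive in R[i] forces [e] to be real. *)
have -> // : (complex.Re e)%:C = e.
by move: e0; rewrite ltcE => /andP[/eqP]; case: (e) => a b /= -> _.
Qed.

Lemma tends_cst l : tends (fun=> l) l.
Proof. by move=> e e0; exists 0%N => n _; rewrite subrr nrm0 ltW. Qed.

Lemma tendsD u v l m : tends u l -> tends v m -> tends (fun n => u n + v n) (l + m).
Proof.
move=> hu hv e e0; have e2 : 0 < e / 2 by lra.
have [N hN] := hu _ e2; have [M hM] := hv _ e2.
exists (maxn N M) => n; rewrite geq_max => /andP[Nn Mn].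
have -> : u n + v n - (l + m) = (u n - l) + (v n - m) by ring.
by apply: le_trans (ler_nrmD _ _) _; have := hN n Nn; have := hM n Mn; lra.
Qed.

Lemma tendsM u v l m : tends u l -> tends v m -> tends (fun n => u n * v n) (l * m).
Proof.
move=> hu hv e e0.
have l0 := nrm_ge0 l; have m0 := nrm_ge0 m.
(* Chosen so that d <= 1 and d (|l| + |m| + 1) <= e; these bound d^2 + |l| d + d |m| by e. *)
pose d := e / (nrm l + nrm m + 2 + e).
have d0 : 0 < d by apply: divr_gt0 => //; lra.
have dE : d * (nrm l + nrm m + 2 + e) = e by rewrite /d divfK //; lra.
have d1 : d <= 1 by rewrite /d ler_pdivrMr; lra.
have [N hN] := hu _ d0; have [M hM] := hv _ d0.
exists (maxn N M) => n; rewrite geq_max => /andP[Nn Mn].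
have -> : u n * v n - l * m = (u n - l) * (v n - m) + (l * (v n - m) + (u n - l) * m) by ring.
apply: le_trans (ler_nrmD _ _) _; rewrite nrmM.
have := ler_nrmD (l * (v n - m)) ((u n - l) * m); rewrite !nrmM.
have := hN n Nn; have := hM n Mn; have := nrm_ge0 (u n - l); have := nrm_ge0 (v n - m).
set a := nrm (u n - l); set b := nrm (v n - m); move=> *; nra.
Qed.

Lemma tends_sum (I : Type) (s : seq I) (P : pred I) (u : I -> nat -> R[i]) (l : I -> R[i]) :
  (forall i, P i -> tends (u i) (l i)) ->
  tends (fun n => \sum_(i <- s | P i) u i n) (\sum_(i <- s | P i) l i).
Proof.
move=> h; elim: s => [|i s IH].
  under eq_fun do rewrite big_nil.
  by rewrite big_nil; exact: tends_cst.
under eq_fun do rewrite big_cons.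
by rewrite big_cons; case: ifP => // Pi; apply: tendsD => //; exact: h.
Qed.

Lemma tends_prod (I : Type) (s : seq I) (P : pred I) (u : I -> nat -> R[i]) (l : I -> R[i]) :
  (forall i, P i -> tends (u i) (l i)) ->
  tends (fun n => \prod_(i <- s | P i) u i n) (\prod_(i <- s | P i) l i).
Proof.
move=> h; elim: s => [|i s IH].
  under eq_fun do rewrite big_nil.
  by rewrite big_nil; exact: tends_cst.
under eq_fun do rewrite big_cons.
by rewrite big_cons; case: ifP => // Pi; apply: tendsM => //; exact: h.
Qed.

Lemma tends_bound u l z B : tends u l ->
  (exists N, forall n, (N <= n)%N -> nrm (u n - z) <= B) -> nrm (l - z) <= B.
Proof.
move=> h [N hN]; apply/ler_addgt0Pr => e /h[M hM].
have := hN (maxn N M) (leq_maxl _ _); have := hM (maxn N M) (leq_maxr _ _).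
by have := ler_nrm_dist l (u (maxn N M)) z; rewrite (nrmB l (u _)); lra.
Qed.

Lemma tends_shift u l k : tends u l -> tends (fun n => u (n - k)%N) l.
Proof.
move=> h e /h[N hN]; exists (N + k)%N => n hn; apply: hN; lia.
Qed.
End ComplexNorm.

(** * Absolutely convergent series and elementary comparison bounds *)

Section AbsoluteSeries.
Variable R : realType.
Implicit Types (a : nat -> R) (u : nat -> R[i]).

Lemma ler_sum_uniq (T : eqType) (s t : seq T) (F : T -> R) : (forall x, 0 <= F x) ->
  uniq s -> uniq t -> {subset s <= t} -> \sum_(x <- s) F x <= \sum_(x <- t) F x.
Proof.
move=> F0 us ut st.
rewrite [leRHS](bigID (mem s)) /= -[leLHS]addr0; apply: lerD; last exact: sumr_ge0.
rewrite -[leRHS]big_filter le_eqVlt; apply/orP; left; apply/eqP/perm_big/uniq_perm => //.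
  exact: filter_uniq.
by move=> n; rewrite mem_filter; case ns: (n \in s) => //=; rewrite st.
Qed.

(** A partial sum within e of the supremum leaves at most e for everything beyond it. The tail is
    taken over arbitrary finite sets, not intervals, because it is applied to smooth numbers. *)
Lemma bounded_series_tail a M : (forall n, 0 <= a n) ->
  (forall N, \sum_(0 <= n < N) a n <= M) ->
  forall e, 0 < e -> exists N, forall s : seq nat, uniq s ->
    (forall n, n \in s -> (N <= n)%N) -> \sum_(n <- s) a n <= e.
Proof.
move=> a0 aM e e0; pose S := [set x | exists N, x = \sum_(0 <= n < N) a n].
have supS : has_sup S.
  split; first by exists (\sum_(0 <= n < 0) a n), 0%N.
  by exists M => _ [N ->].
have [_ [N ->] hN] := sup_adherent e0 supS.
exists N => s us sN.
pose L := (\max_(n <- s) n).+1.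
have sL n : n \in s -> (n < L)%N by move=> ns; rewrite ltnS; exact: leq_bigmax_seq.
have le1 : \sum_(n <- s) a n <= \sum_(N <= n < maxn N L) a n.
  apply: ler_sum_uniq => // [|n ns]; first exact: iota_uniq.
  by rewrite mem_index_iota sN // leq_max sL // orbT.
apply: le_trans le1 _.
have : \sum_(0 <= n < maxn N L) a n <= sup S.
  by apply: ub_le_sup; [exists M => _ [K ->] | exists (maxn N L)].
by rewrite (big_cat_nat _ (leq_maxl N L)) //=; lra.
Qed.

Lemma real_series_tends (x : nat -> R) M : (forall N, \sum_(0 <= n < N) `|x n| <= M) ->
  exists l : R, forall e, 0 < e -> exists N, forall n, (N <= n)%N ->
    `|\sum_(0 <= i < n) x i - l| <= e.
Proof.
move=> xM.
have cx : cvgn (series x).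
  apply: normed_cvg; apply: nondecreasing_is_cvgn.
    by apply: nondecreasing_series => n _ _ /=.
  by exists M => _ [N _ <-]; exact: xM.
exists (limn (series x)) => e e0.
have /cvgrPdist_le/(_ _ e0)[N _ hN] := cx.
by exists N => n Nn; rewrite distrC; exact: hN.
Qed.

Lemma abs_series_tends u M : (forall N, \sum_(0 <= n < N) nrm (u n) <= M) ->
  exists l, tends (fun N => \sum_(0 <= n < N) u n) l.
Proof.
move=> uM.
have [x hx] : exists l : R, forall e, 0 < e -> exists N, forall n, (N <= n)%N ->
    `|\sum_(0 <= i < n) complex.Re (u i) - l| <= e.
  apply: (@real_series_tends _ M) => N; apply: le_trans (uM N).
  by apply: ler_sum => n _; exact: nrm_geRe.
have [y hy] : exists l : R, forall e, 0 < e -> exists N, forall n, (N <= n)%N ->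
    `|\sum_(0 <= i < n) complex.Im (u i) - l| <= e.
  apply: (@real_series_tends _ M) => N; apply: le_trans (uM N).
  by apply: ler_sum => n _; exact: nrm_geIm.
exists (x +i* y) => e e0; have e2 : 0 < e / 2 by lra.
have [N hN] := hx _ e2; have [K hK] := hy _ e2.
exists (maxn N K) => n; rewrite geq_max => /andP[Nn Kn].
apply: le_trans (nrm_le_ReIm _) _.
have -> : \sum_(0 <= i < n) u i - (x +i* y)
   = (\sum_(0 <= i < n) complex.Re (u i) - x) +i* (\sum_(0 <= i < n) complex.Im (u i) - y).
  have -> : \sum_(0 <= i < n) u i
     = (\sum_(0 <= i < n) complex.Re (u i)) +i* (\sum_(0 <= i < n) complex.Im (u i)).
    by elim/big_rec3: _ => // i a b c _ ->; case: (u i).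
  by [].
by rewrite /=; have := hN n Nn; have := hK n Kn; lra.
Qed.

Lemma geometric_sum_le (q : R) n : 0 <= q < 1 -> \sum_(0 <= i < n) q ^+ i <= (1 - q)^-1.
Proof.
move=> /andP[q0 q1]; rewrite -[leLHS](mulfK (_ : 1 - q != 0)); last by lra.
apply: ler_piMl; first by rewrite invr_ge0; lra.
have -> : (\sum_(0 <= i < n) q ^+ i) * (1 - q) = 1 - q ^+ n.
  elim: n => [|n IH]; first by rewrite big_geq // expr0; ring.
  by rewrite big_nat_recr //= mulrDl IH exprS; ring.
by rewrite gerBl exprn_ge0.
Qed.

(** Both bounds are ln(1 + t) <= t, with t = 1/d and with t = -1/(d+1). *)
Lemma ln_ratio_bounds d : (0 < d)%N ->
  d.+1%:R^-1 <= ln d.+1%:R - ln (d%:R : R) <= d%:R^-1.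
Proof.
move=> d0; have dR : (0 : R) < d%:R by rewrite ltr0n.
have eR : (0 : R) < d.+1%:R by rewrite ltr0n.
apply/andP; split.
  rewrite -ln_div ?posrE // -[leRHS]opprK -lnV ?posrE ?divr_gt0 // invf_div.
  have -> : d%:R / d.+1%:R = 1 + - d.+1%:R^-1 :> R.
    have e0' := lt0r_neq0 eR.
    apply: (mulIf e0'); rewrite divfK // mulrDl mulNr mulVf // mul1r.
    by rewrite -natr1 addrK.
  by rewrite lerNr; apply: le_ln1Dx; rewrite ltrN2 invf_lt1 // ltr1n.
rewrite -ln_div ?posrE //.
have -> : d.+1%:R / d%:R = 1 + d%:R^-1 :> R.
  by rewrite -natr1 mulrDl divff ?gt_eqF // mul1r.
apply: le_ln1Dx; have : (0 : R) < d%:R^-1 by rewrite invr_gt0.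
lra.
Qed.

Lemma sum_powR_le (b : R) N : 0 < b ->
  \sum_(1 <= n < N) n%:R `^ (- (1 + b)) <= 1 + b^-1.
Proof.
move=> b0; have bV : 0 < b^-1 by rewrite invr_gt0.
case: N => [|N]; first by rewrite big_geq //; lra.
(* The subtracted term is the tail of the integral of t^(-1-b), which makes the bound inductive. *)
suff : \sum_(1 <= n < N.+2) n%:R `^ (- (1 + b)) <= 1 + b^-1 - b^-1 * N.+1%:R `^ (- b).
  move=> h; apply: le_trans (_ : _ <= \sum_(1 <= n < N.+2) n%:R `^ (- (1 + b))) _.
    by rewrite [leRHS]big_nat_recr //= lerDl powR_ge0.
  apply: le_trans h _; have := powR_ge0 N.+1%:R (- b); nra.
elim: N => [|N IH]; first by rewrite big_nat1 !powR1; lra.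
rewrite big_nat_recr //=.
(* One step of the integral comparison; it follows from e^t >= 1 + t with t = b ln((N+2)/(N+1)). *)
suff : b * N.+2%:R `^ (- (1 + b)) <= N.+1%:R `^ (- b) - N.+2%:R `^ (- b).
  by rewrite -(ler_pM2l bV) mulrA mulVf ?lt0r_neq0 // mul1r; lra.
have n0 : (0 : R) < N.+1%:R by rewrite ltr0n.
have m0 : (0 : R) < N.+2%:R by rewrite ltr0n.
have -> : N.+1%:R `^ (- b) = N.+2%:R `^ (- b) * expR (b * ln (N.+2%:R / N.+1%:R)) :> R.
  rewrite ln_div ?posrE // /powR !gt_eqF // -expRD; congr expR; move: (ln N.+1%:R) (ln N.+2%:R) => u v; ring.
rewrite opprD powRD; last by rewrite (gt_eqF m0) implybT.
rewrite (powR_inv1 (ltW m0)).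
have /andP[L _] := ln_ratio_bounds (ltn0Sn N); rewrite -ln_div ?posrE // in L.
have := expR_ge1Dx (b * ln (N.+2%:R / N.+1%:R)).
have := powR_gt0 (- b) m0; set t := N.+2%:R `^ _; set E := expR _.
set l := ln _ in L *; set w := N.+2%:R^-1 in L *.
move=> t0 hE. have h : b * w <= E - 1 by have := ler_wpM2l (ltW b0) L; lra.
by have := ler_wpM2l (ltW t0) h; lra.
Qed.
End AbsoluteSeries.

(** * Summatory function of the Piltz divisor function *)

Section PiltzSum.
Variable R : realType.

Lemma truncn_divn (x : R) d : 0 <= x -> (0 < d)%N ->
  Num.truncn (x / d%:R) = (Num.truncn x %/ d)%N.
Proof.
move=> x0 d0; have dR : (0 : R) < d%:R by rewrite ltr0n.
have /andP[tx xt] := truncn_itv x0.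
apply/eqP; rewrite truncn_eq ?divr_ge0 ?ler0n //.
rewrite ler_pdivlMr // ltr_pdivrMr // -!natrM; apply/andP; split.
  by apply: le_trans tx; rewrite ler_nat leq_trunc_div.
apply: lt_le_trans xt _; rewrite ler_nat; exact: ltn_ceil.
Qed.

Definition Tsum k N : R := \sum_(1 <= n < N.+1) (tau k n)%:R.

Lemma TsumS k N : Tsum k.+1 N = \sum_(1 <= d < N.+1) Tsum k (N %/ d).
Proof.
rewrite /Tsum -(@sum_big_divisors _ N (fun d m => (tau k m)%:R)).
apply: eq_big_nat => n /andP[n0 _]; rewrite tau_lcm_conv // lcm_conv1 //.
rewrite big_seq [RHS]big_seq; apply: eq_bigr => d; rewrite -dvdn_divisors // => dn.
by rewrite tau_lcm_conv // divn_gt0 ?(dvdn_gt0 n0 dn) // dvdn_leq.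
Qed.

Lemma Tsum0 N : (0 < N)%N -> Tsum 0 N = 1.
Proof.
move=> N0; rewrite /Tsum big_nat_recl // tau_lcm_conv //= big1_seq ?addr0 //.
by move=> n /andP[_]; rewrite mem_index_iota => /andP[n1 _]; rewrite tau_lcm_conv //=; case: n n1.
Qed.

Lemma Tsum1 N : Tsum 1 N = N%:R.
Proof.
rewrite TsumS (eq_big_nat _ _ (F2 := fun=> 1)) ?sumr_const_nat ?subn1 //.
by move=> d /andP[d0 dN]; rewrite Tsum0 // divn_gt0.
Qed.

(** An algebraic mean value theorem: a^(j+1) - b^(j+1) is (a - b) times j + 1 monomials lying
    between b^j and a^j. *)
Lemma pow_diff_bounds (a b : R) j : 0 <= b -> b <= a ->
  j.+1%:R * b ^+ j * (a - b) <= a ^+ j.+1 - b ^+ j.+1 <= j.+1%:R * a ^+ j * (a - b).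
Proof.
move=> b0 ba; have a0 := le_trans b0 ba; have ab : 0 <= a - b by rewrite subr_ge0.
rewrite subrXX (mulrC (a - b)); apply/andP; split; apply: ler_wpM2r => //.
  rewrite mulr_natl -[X in _ *+ X]card_ord -sumr_const.
  apply: ler_sum => i _; rewrite /= -[in leLHS](subnK (leq_ord i)) exprD.
  by rewrite ler_wpM2r ?exprn_ge0 // lerXn2r ?nnegrE.
rewrite mulr_natl -[X in _ *+ X]card_ord -sumr_const.
apply: ler_sum => i _; rewrite /= -[in leRHS](subnK (leq_ord i)) exprD.
by rewrite ler_wpM2l ?exprn_ge0 // lerXn2r ?nnegrE.
Qed.

(** Integral comparison without integrals: ln(x/t)^j / t decreases on [1, x] and has the primitive
    -ln(x/t)^(j+1)/(j+1), so sum and integral differ by at most the first term ln(x)^j. *)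
Lemma log_pow_sum (x : R) j : 1 <= x ->
  0 <= \sum_(1 <= d < (Num.truncn x).+1) d%:R^-1 * ln (x / d%:R) ^+ j
       - ln x ^+ j.+1 / j.+1%:R <= ln x ^+ j.
Proof.
move=> x1; have x0 : 0 < x by lra.
have /andP[Nx xN] := truncn_itv (ltW x0).
set N := Num.truncn x in Nx xN *.
have N0 : (0 < N)%N by rewrite -ltnS -(ltr_nat R); apply: le_lt_trans xN.
pose L d := ln (x / d%:R) : R.
have L1 : L 1%N = ln x by rewrite /L divr1.
have LE d : (0 < d)%N -> L d = ln x - ln d%:R.
  by move=> d0; rewrite /L ln_div ?posrE ?ltr0n.
have L0 d : (0 < d <= N)%N -> 0 <= L d.
  move=> /andP[d0 dN]; apply: ln_ge0; rewrite ler_pdivlMr ?ltr0n // mul1r.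
  by apply: le_trans Nx; rewrite ler_nat.
have j0 : (0 : R) < j.+1%:R by rewrite ltr0n.
have step d : (0 < d < N)%N ->
   j.+1%:R * (d.+1%:R^-1 * L d.+1 ^+ j) <= L d ^+ j.+1 - L d.+1 ^+ j.+1
     <= j.+1%:R * (d%:R^-1 * L d ^+ j).
  move=> /andP[d0 dN].
  have La : 0 <= L d by apply: L0; rewrite d0 ltnW.
  have Lb : 0 <= L d.+1 by apply: L0.
  have /andP[r1 r2] := ln_ratio_bounds R d0.
  have dE : L d - L d.+1 = ln d.+1%:R - ln d%:R by rewrite !LE //; lra.
  have Lab : L d.+1 <= L d.
    by rewrite -subr_ge0 dE; apply: le_trans r1; rewrite invr_ge0.
  have /andP[p1 p2] := pow_diff_bounds j Lb Lab.
  rewrite -!mulrA in p1 p2; apply/andP; split.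
    apply: le_trans p1; apply: ler_wpM2l; first exact: ltW.
    by rewrite mulrC ler_wpM2l ?exprn_ge0 // dE.
  apply: le_trans p2 _; apply: ler_wpM2l; first exact: ltW.
  by rewrite mulrC ler_wpM2r ?exprn_ge0 // dE.
have tel M : (M < N)%N ->
  j.+1%:R * \sum_(1 <= d < M.+1) d.+1%:R^-1 * L d.+1 ^+ j <= L 1%N ^+ j.+1 - L M.+1 ^+ j.+1
  <= j.+1%:R * \sum_(1 <= d < M.+1) d%:R^-1 * L d ^+ j.
  elim: M => [|M IH] MN; first by rewrite !big_geq // mulr0 subrr lexx.
  have /andP[h1 h2] := IH (ltnW MN); have /andP[s1 s2] := step M.+1 MN.
  rewrite !(@big_nat_recr _ _ _ M.+1 1) //= !mulrDr.
  by apply/andP; split; [have := lerD h1 s1 | have := lerD h2 s2]; rewrite addrA subrK.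
have /andP[t1 t2] := tel N.-1 ltac:(by rewrite prednK).
rewrite prednK // in t1 t2; rewrite -/L.
have N0R : (0 : R) < N%:R by rewrite ltr0n.
(* The incomplete last interval [N, x] contributes ln(x/N)^(j+1)/(j+1); by this bound the term d = N
   covers it. *)
have NL : L N <= N%:R^-1.
  have -> : L N = ln (1 + (x / N%:R - 1)) by congr ln; ring.
  have h : 1 <= x / N%:R by rewrite ler_pdivlMr // mul1r.
  apply: le_trans (le_ln1Dx _) _; first by lra.
  rewrite lerBlDr ler_pdivrMr // mulrDl mulVf ?gt_eqF // mul1r addrC natr1.
  exact: ltW.
have LN0 : 0 <= L N by apply: L0; rewrite N0 leqnn.
set A := ln x ^+ j.+1; have AE : A = A / j.+1%:R * j.+1%:R by rewrite divfK ?gt_eqF.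
set S := \sum_(1 <= d < N.+1) _.
have SE : S = \sum_(1 <= d < N) d%:R^-1 * L d ^+ j + N%:R^-1 * L N ^+ j.
  by rewrite /S big_nat_recr.
have SE' : S = ln x ^+ j + \sum_(1 <= d < N) d.+1%:R^-1 * L d.+1 ^+ j.
  by rewrite /S big_ltn // invr1 mul1r mulr1 big_add1.
have LNj : L N ^+ j.+1 <= N%:R^-1 * L N ^+ j.
  by rewrite exprS ler_wpM2r ?exprn_ge0.
have LNj0 : 0 <= N%:R^-1 * L N ^+ j by rewrite mulr_ge0 ?invr_ge0 ?exprn_ge0 // ltW.
have j1 : (1 : R) <= j.+1%:R by rewrite ler1n.
rewrite L1 -/A in t1 t2.
apply/andP; split.
  rewrite subr_ge0 -(ler_pM2r j0) -AE SE mulrDl.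
  have : N%:R^-1 * L N ^+ j <= N%:R^-1 * L N ^+ j * j.+1%:R by rewrite ler_peMr.
  lra.
rewrite lerBlDr SE' lerD2l -(ler_pM2r j0) -AE.
have : 0 <= L N ^+ j.+1 by rewrite exprn_ge0.
lra.
Qed.

(** The approximation is inserted at each y = x/d in the recursion [TsumS]; the main terms are
    summed by [log_pow_sum], whose error gives x ln(x)^j. *)
Lemma Tsum_step m j (e : R -> R) :
  (forall y, 1 <= y -> `|Tsum m (Num.truncn y) - y * ln y ^+ j / j`!%:R| <= e y) ->
  forall x, 1 <= x ->
  `|Tsum m.+1 (Num.truncn x) - x * ln x ^+ j.+1 / j.+1`!%:R|
    <= \sum_(1 <= d < (Num.truncn x).+1) e (x / d%:R) + x * ln x ^+ j.
Proof.
move=> h x x1; have x0 : 0 < x by lra.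
have /andP[Nx xN] := truncn_itv (ltW x0).
have /andP[l1 l2] := log_pow_sum j x1.
rewrite TsumS; set N := Num.truncn x in Nx xN l1 l2 *.
set W := \sum_(1 <= d < N.+1) d%:R^-1 * _ in l1 l2.
have -> : \sum_(1 <= d < N.+1) Tsum m (N %/ d) - x * ln x ^+ j.+1 / j.+1`!%:R
  = \sum_(1 <= d < N.+1) (Tsum m (N %/ d) - x / d%:R * ln (x / d%:R) ^+ j / j`!%:R)
    + x / j`!%:R * (W - ln x ^+ j.+1 / j.+1%:R).
  have WE : x / j`!%:R * W = \sum_(1 <= d < N.+1) x / d%:R * ln (x / d%:R) ^+ j / j`!%:R.
    by rewrite /W big_distrr /=; apply: eq_bigr => d _; move: (ln _ ^+ j) => w; ring.
  rewrite sumrB mulrBr WE subrKA; congr (_ - _).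
  rewrite factS natrM invfM; ring.
apply: le_trans (ler_normD _ _) _; apply: lerD.
  apply: le_trans (ler_norm_sum _ _ _) _; apply: ler_sum_nat => d /andP[d0 dN].
  rewrite -truncn_divn ?(ltW x0) //; apply: h.
  rewrite ler_pdivlMr ?ltr0n // mul1r; apply: le_trans Nx.
  by rewrite ler_nat -ltnS.
have f1 : (1 : R) <= j`!%:R by rewrite ler1n fact_gt0.
have fx : x / j`!%:R <= x by rewrite ler_piMr ?(ltW x0) // invf_le1 // (lt_le_trans ltr01).
rewrite normrM ger0_norm; last by rewrite divr_ge0 ?(ltW x0) ?ler0n.
rewrite ger0_norm //; apply: ler_pM => //.
by rewrite divr_ge0 ?(ltW x0) ?ler0n.
Qed.

Lemma harmonic_le (x : R) : 1 <= x ->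
  \sum_(1 <= d < (Num.truncn x).+1) d%:R^-1 <= 1 + ln x.
Proof.
move=> x1; have /andP[_] := log_pow_sum 0 x1.
rewrite (eq_bigr (fun d => d%:R^-1)); last by move=> d _; rewrite expr0 mulr1.
by rewrite expr1 expr0 divr1; lra.
Qed.

(** Each passage from tau_m to tau_(m+1) costs a harmonic sum, at most 1 + ln x, so the error always
    stays one logarithm below the main term. Powers of 1 + ln x, not of ln x, keep the bound valid
    at x = 1. *)
Lemma Tsum_asymp k : exists2 K : R, 0 <= K & forall x, 1 <= x ->
  `|Tsum k.+2 (Num.truncn x) - x * ln x ^+ k.+1 / k.+1`!%:R| <= K * x * (1 + ln x) ^+ k.
Proof.
elim: k => [|k [K K0 IH]].
  (* The fractional parts in T_1(y) = floor(y) add up to at most x, and [log_pow_sum] with j = 0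
     costs another x. *)
  exists 2 => // x x1; have x0 : 0 < x by lra.
  have /andP[Nx xN] := truncn_itv (ltW x0).
  have h1 y : 1 <= y -> `|Tsum 1 (Num.truncn y) - y * ln y ^+ 0 / 0`!%:R| <= 1.
    move=> y1; have /andP[ty yt] : (Num.truncn y)%:R <= y < (Num.truncn y).+1%:R.
      by apply: truncn_itv; lra.
    rewrite -natr1 in yt.
    by rewrite Tsum1 expr0 fact0 mulr1 divr1 ler_norml; apply/andP; split; lra.
  apply: le_trans (Tsum_step h1 x1) _.
  by rewrite sumr_const_nat subn1 /= !expr0; lra.
exists (K + 1); first by lra.
move=> x x1; have x0 : 0 < x by lra.
have l0 : 0 <= ln x by apply: ln_ge0.
have /andP[Nx xN] := truncn_itv (ltW x0).
apply: le_trans (Tsum_step IH x1) _.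
have -> : (K + 1) * x * (1 + ln x) ^+ k.+1 = K * x * (1 + ln x) ^+ k * (1 + ln x) + x * (1 + ln x) ^+ k.+1.
  by rewrite exprS; ring.
apply: lerD; last first.
  by rewrite ler_wpM2l ?(ltW x0) // lerXn2r ?nnegrE; lra.
apply: le_trans (_ : _ <= K * x * (1 + ln x) ^+ k * \sum_(1 <= d < (Num.truncn x).+1) d%:R^-1) _.
  rewrite big_distrr /=; apply: ler_sum_nat => d /andP[d0 dN].
  have d0R : (0 : R) < d%:R by rewrite ltr0n.
  have -> : K * (x / d%:R) * (1 + ln (x / d%:R)) ^+ k = K * x * (1 + ln (x / d%:R)) ^+ k / d%:R by ring.
  rewrite ler_wpM2r ?invr_ge0 ?(ltW d0R) // ler_wpM2l ?mulr_ge0 ?(ltW x0) //.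
  have xd : 1 <= x / d%:R.
    by rewrite ler_pdivlMr // mul1r (le_trans _ Nx) // ler_nat -ltnS.
  have ld := ln_ge0 xd.
  rewrite lerXn2r ?nnegrE ?lerD2l //; [lra|lra|].
  rewrite ler_ln ?posrE ?divr_gt0 // ler_piMr ?(ltW x0) // invf_le1 // ler1n //.
rewrite ler_wpM2l ?harmonic_le // mulr_ge0 ?exprn_ge0 ?mulr_ge0 ?(ltW x0) //.
lra.
Qed.
End PiltzSum.

(** * Polynomials in ln x and the choice of the main term *)

Section PiltzPoly.
Variable R : realType.
Implicit Types (A B D P : {poly R}).

(** Induction along the Horner scheme: half of [eta] bounds the quotient polynomial, the other half
    absorbs the factor u <= (2/eta) e^(eta u/2). *)
Lemma horner_expR_bound A (eta : R) : 0 < eta ->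
  exists2 K : R, 0 <= K & forall u, 0 <= u -> `|A.[u]| <= K * expR (eta * u).
Proof.
elim/poly_ind: A eta => [|A c IH] eta eta0.
  by exists 0 => // u _; rewrite horner0 normr0 mul0r.
have eta2 : 0 < eta / 2 by lra.
have [K K0 hK] := IH _ eta2; have V0 : 0 < (eta / 2)^-1 by rewrite invr_gt0.
exists (K * (eta / 2)^-1 + `|c|); first by rewrite addr_ge0 ?mulr_ge0 // ltW.
move=> u u0; rewrite hornerMXaddC; apply: le_trans (ler_normD _ _) _.
rewrite mulrDl; apply: lerD; last first.
  by rewrite ler_peMr // -expR0 ler_expR mulr_ge0 // ltW.
have -> : expR (eta * u) = expR (eta / 2 * u) * expR (eta / 2 * u).
  by rewrite -expRD; congr expR; lra.
rewrite normrM (ger0_norm u0).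
have h : u <= (eta / 2)^-1 * expR (eta / 2 * u).
  rewrite -(ler_pM2l eta2) mulrA divff ?gt_eqF // mul1r.
  by have := expR_ge1Dx (eta / 2 * u); lra.
apply: le_trans (ler_pM _ u0 (hK _ u0) h) _; first exact: normr_ge0.
by move: (expR _) => E; rewrite le_eqVlt; apply/orP; left; apply/eqP; ring.
Qed.

Lemma horner_ln_bound A (eta : R) : 0 < eta ->
  exists2 K : R, 0 <= K & forall x, 1 <= x -> `|A.[ln x]| <= K * x `^ eta.
Proof.
move=> /(horner_expR_bound A)[K K0 hK]; exists K => // x x1.
by rewrite /powR gt_eqF; [apply/hK/ln_ge0 | lra].
Qed.

(** If deg D > n, then D - K (1 + t)^n has the leading coefficient of D, which may be taken
    positive, and so is eventually at least that coefficient; the hypothesis makes it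
    nonpositive. *)
Lemma size_poly_le_growth D K n t0 :
  (forall t, t0 <= t -> `|D.[t]| <= K * (1 + t) ^+ n) -> (size D <= n.+1)%N.
Proof.
wlog lD : D / 0 < lead_coef D => [W h|h].
  case: (ltrgt0P (lead_coef D)) => [lD|lD|/eqP]; first exact: W.
    rewrite -size_polyN; apply: W => [|t tt]; first by rewrite lead_coefN oppr_gt0.
    by rewrite hornerN normrN h.
  by rewrite lead_coef_eq0 => /eqP ->; rewrite size_poly0.
rewrite leqNgt; apply/negP => sD.
pose E := D - K *: ('X - (-1)%:P) ^+ n.
have lE : lead_coef E = lead_coef D.
  rewrite lead_coefDl // size_polyN; apply: leq_ltn_trans (size_scale_leq _ _) _.
  by rewrite size_exp_XsubC.
have [|m hm] := @polyrcf.poly_pinfty_gt_lc _ E; first by rewrite lE.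
have /hm : m <= Num.max m t0 by rewrite le_max lexx.
have := h (Num.max m t0); rewrite le_max lexx orbT => /(_ isT).
rewrite lE /E !hornerE opprK [_ + 1]addrC.
by have := ler_norm (D.[Num.max m t0]); lra.
Qed.

Definition piltz_error k P (theta : R) : Prop :=
  forall eps : R, 0 < eps ->
    exists K : R, \forall x \near +oo,
      `|tau_sum k x - x * P.[ln x]| <= K * x `^ (theta + eps).

Lemma tau_sumE k x : tau_sum k x = Tsum R k (Num.truncn x).
Proof. by []. Qed.

Lemma Tsum_ge0 k N : 0 <= Tsum R k N.
Proof. by apply: sumr_ge0. Qed.

Lemma Tsum_le k M N : (M <= N)%N -> Tsum R k M <= Tsum R k N.
Proof.
move=> MN; rewrite /Tsum (@big_cat_nat _ _ _ M.+1 1 N.+1) //= lerDl.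
exact: sumr_ge0.
Qed.

(** On a bounded range both terms are bounded while x^(theta+eps) >= 1, so a larger constant extends
    the estimate from large x to all x >= 1. *)
Lemma piltz_error_uniform k P theta : 0 <= theta -> piltz_error k P theta ->
  forall eps : R, 0 < eps -> exists2 K : R, 0 <= K & forall x, 1 <= x ->
    `|Tsum R k (Num.truncn x) - x * P.[ln x]| <= K * x `^ (theta + eps).
Proof.
move=> th0 hP eps eps0; have [K [M [_ hM]]] := hP _ eps0.
have [B B0 hB] := horner_ln_bound P (ltr01 : 0 < 1 :> R).
pose M1 := Num.max 1 M.
have M11 : 1 <= M1 by rewrite le_max lexx.
pose K1 := Tsum R k (Num.truncn M1) + M1 * (B * M1).
have K10 : 0 <= K1 by rewrite addr_ge0 ?Tsum_ge0 ?mulr_ge0 //; lra.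
exists (`|K| + K1); first by rewrite addr_ge0.
move=> x x1; case: (ltP M x) => [/hM|xM].
  rewrite tau_sumE => /le_trans; apply; rewrite ler_wpM2r ?powR_ge0 //.
  by have := ler_norm K; lra.
have xM1 : x <= M1 by rewrite le_max xM orbT.
apply: le_trans (_ : _ <= K1) _.
  apply: le_trans (ler_normB _ _) _; apply: lerD.
    by rewrite ger0_norm ?Tsum_ge0 //; apply: Tsum_le; apply: le_truncn.
  rewrite normrM ger0_norm; last lra.
  apply: ler_pM => //; first lra.
  apply: le_trans (hB _ x1) _; rewrite powRr1; last lra.
  exact: ler_wpM2l.
rewrite -[leLHS]mulr1; apply: ler_pM => //; first by rewrite lerDr.
by rewrite -(powRr0 x); apply: ler_powR => //; lra.
Qed.

(* When no exponent below 1 is admissible, the polynomial only has to have the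
   right leading term, since then every admissible error exceeds the main term. *)
Lemma piltz_main k P : (2 <= k)%N ->
  exists P' : {poly R}, [/\ (size P' <= k)%N, P'`_k.-1 = (k.-1)`!%:R^-1 &
    forall theta, 1 / 2 <= theta -> piltz_error k P theta ->
    forall eps : R, 0 < eps -> exists2 K : R, 0 <= K & forall x, 1 <= x ->
      `|Tsum R k (Num.truncn x) - x * P'.[ln x]| <= K * x `^ (theta + eps)].
Proof.
case: k => [|[|k]] // _; have [K K0 hK] := Tsum_asymp R k.
pose L : {poly R} := (k.+1)`!%:R^-1 *: 'X^(k.+1).
have sL : (size L <= k.+2)%N.
  by apply: leq_trans (size_scale_leq _ _) _; rewrite size_polyXn.
have cL : L`_k.+1 = (k.+1)`!%:R^-1 by rewrite coefZ coefXn eqxx mulr1.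
have LE x : L.[ln x] = ln x ^+ k.+1 / (k.+1)`!%:R.
  by rewrite hornerZ hornerXn mulrC.
have [[th [th0 th1 hth]]|no] := pselect (exists th, [/\ 1 / 2 <= th, th < 1 & piltz_error k.+2 P th]).
  exists P; suff sPL : (size (P - L)%R <= k.+1)%N.
    have PE : P = L + (P - L) by rewrite addrC subrK.
    split.
    - rewrite PE; apply: leq_trans (size_polyD _ _) _.
      by rewrite geq_max sL (leq_trans sPL).
    - by rewrite PE coefD cL [X in _ + X]nth_default ?addr0.
    - by move=> theta t0; apply: piltz_error_uniform; lra.
  (* With eps = 1 - th the admissible error is O(x). Comparing it with [Tsum_asymp] at x = e^t gives
     P(t) - L(t) = O((1 + t)^k), so [P] and [L] share their top coefficient. *)
  have e0 : 0 < 1 - th by lra.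
  have th00 : 0 <= th by lra.
  have [K1 K10 hK1] := piltz_error_uniform th00 hth e0.
  apply: (@size_poly_le_growth _ (K + K1) _ 0) => t t0.
  have x1 : 1 <= expR t by rewrite -expR0 ler_expR.
  have x0 := expR_gt0 t.
  have := hK _ x1; have := hK1 _ x1; rewrite expRK [th + _]addrC subrK powRr1 ?(ltW x0) //.
  set T := Tsum R _ _; set x := expR t in x0 *.
  move=> h1 h2; rewrite -(ler_pM2l x0) -{1}(gtr0_norm x0) -normrM hornerD hornerN.
  have -> : L.[t] = t ^+ k.+1 / (k.+1)`!%:R by rewrite -[t in RHS]expRK -LE expRK.
  have -> : x * (P.[t] - t ^+ k.+1 / (k.+1)`!%:R)
     = (T - x * t ^+ k.+1 / (k.+1)`!%:R) - (T - x * P.[t]) by ring.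
  apply: le_trans (ler_normB _ _) _.
  have p1 : 1 <= (1 + t) ^+ k by rewrite exprn_ege1; lra.
  have : K1 * x <= K1 * x * (1 + t) ^+ k by rewrite ler_peMr ?mulr_ge0 // ltW.
  lra.
(* Every admissible exponent is now at least 1, so the elementary error x (1 + ln x)^k is already
   O(x^(th+eps)) and the leading monomial alone serves as main term. *)
exists L; split => // th th0 hth eps eps0.
have th1 : 1 <= th by case: (leP 1 th) => // lt; case: no; exists th.
have [K1 K10 hK1] := horner_ln_bound (('X + 1) ^+ k) eps0.
exists (K * K1); first exact: mulr_ge0.
move=> x x1; have x0 : 0 < x by lra.
rewrite LE mulrA; apply: le_trans (hK _ x1) _.
have := hK1 _ x1; rewrite horner_exp !hornerE => h.
have l0 := ln_ge0 x1.
rewrite powRD; last by rewrite (gt_eqF x0) implybT.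
have xth : x <= x `^ th by exact: le1r_powR.
have h1 : (1 + ln x) ^+ k <= K1 * x `^ eps.
  by apply: le_trans h; rewrite addrC ler_norm.
have -> : K * K1 * (x `^ th * x `^ eps) = K * x `^ th * (K1 * x `^ eps) by ring.
apply: ler_pM => //; [by rewrite mulr_ge0 // ltW|by rewrite exprn_ge0; lra|].
exact: ler_wpM2l.
Qed.

(* The equation makes e^((r+1)u) B(u) an antiderivative of e^((r+1)u) A(u). *)
Lemma exists_twisted_poly (r : R) n A : 0 <= r -> (size A <= n)%N ->
  exists B, [/\ (size B <= n)%N, (r + 1) *: B + B^`() = A & B`_n.-1 = A`_n.-1 / (r + 1)].
Proof.
move=> r0; have r1 : r + 1 != 0 by rewrite gt_eqF //; lra.
elim: n A => [|n IH] A sA.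
  exists 0; rewrite size_poly0 scaler0 deriv0 addr0 coef0.
  by move: sA; rewrite leqn0 size_poly_eq0 => /eqP ->; rewrite coef0 mul0r.
(* The derivative lowers the degree, so the top coefficient is matched by (r + 1) B alone and the
   remainder has lower degree. *)
pose B0 : {poly R} := (A`_n / (r + 1)) *: 'X^n.
have sB0 : (size B0 <= n.+1)%N.
  by apply: leq_trans (size_scale_leq _ _) _; rewrite size_polyXn.
have [|B [sB EB _]] := IH (A - ((r + 1) *: B0 + B0^`())).
  apply/leq_sizeP => i ni; rewrite coefB coefD coefZ coef_deriv !coefZ !coefXn.
  case: (ltngtP i n) => [|ni'|->]; first by rewrite ltnNge ni.
    have sAi : A`_i = 0 by apply/(leq_sizeP _ _ sA).
    rewrite sAi (gtn_eqF (leq_trans ni' (leqnSn i))) !mulr0 mul0rn addr0 ?oppr0 ?addr0 ?subrr //.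
  rewrite (gtn_eqF (ltnSn n)) mulr1 mulr0 mul0rn addr0 mulrC divfK // subrr //.
exists (B0 + B); split.
- by apply: leq_trans (size_polyD _ _) _; rewrite geq_max sB0 (leq_trans sB).
- rewrite scalerDr derivD addrACA EB; exact: subrKC.
- by rewrite /= coefD [B`_n]nth_default // addr0 coefZ coefXn eqxx mulr1.
Qed.
End PiltzPoly.

(** * Partial summation *)

Section PartialSummation.
Variable R : realType.

(** Partial summation for the smooth main terms. With c = e^(rb), the function e^((r+1)u) B(u) - c
    e^u A(u) has derivative (e^(ru) - c) e^u (A + A')(u), which the mean value theorem bounds by the
    increment of e^(ru) over [a, b]. *)
Lemma twisted_poly_increment (A B : {poly R}) (r a b M : R) : 0 <= r ->
  (r + 1) *: B + B^`() = A + A^`() -> a <= b ->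
  (forall u, a <= u <= b -> `|(A + A^`()).[u]| <= M) ->
  `|expR ((r + 1) * b) * B.[b] - expR ((r + 1) * a) * B.[a]
     - expR (r * b) * (expR b * A.[b] - expR a * A.[a])|
  <= (expR (r * b) - expR (r * a)) * M * (expR b * (b - a)).
Proof.
move=> r0 BA ab hM; set c := expR (r * b).
pose phi u := expR ((r + 1) * u) * B.[u] - c * (expR u * A.[u]).
pose dphi u := (expR (r * u) - c) * expR u * (A + A^`()).[u].
have dp (p : {poly R}) (x : R) : is_derive x 1 (horner p) p^`().[x].
  by apply: DeriveDef; [exact: derivable_horner | rewrite -derive1E -derivE].
have de (q x : R) : is_derive x 1 (fun u => expR (q * u)) (q * expR (q * x)).
  have h : is_derive x 1 (fun u : R => q * u) q.
    by apply: is_derive_eq; rewrite /GRing.scale /= mulr1.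
  by have := @is_derive1_comp _ expR (fun u => q * u) x _ _ (is_derive_expR _) h; rewrite mulrC.
have d (x : R) : is_derive x 1 phi (dphi x).
  have h1 := is_deriveM (de (r + 1) x) (dp B x).
  have h2 := is_deriveZ c (is_deriveM (is_derive_expR x) (dp A x)).
  have h3 := is_deriveB h1 h2.
  apply: is_derive_eq h3 _; rewrite /dphi /GRing.scale /= -BA.
  have -> : expR (r * x) = expR ((r + 1) * x) / expR x.
    by rewrite -expRN -expRD; congr expR; ring.
  have hA : ((r + 1) *: B + B^`()).[x] = A.[x] + A^`().[x] by rewrite BA hornerD.
  have hB : ((r + 1) *: B + B^`()).[x] = (r + 1) * B.[x] + B^`().[x].
    by rewrite hornerD hornerZ.
  rewrite !mulrBl divfK ?gt_eqF ?expR_gt0 // {1}hB hA.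
  move: (expR _) (expR _) => X Y; ring.
have [|z] := @MVT_segment _ phi dphi a b ab (fun x _ => d x).
  apply: derivable_within_continuous => x _; exact: ex_derive.
rewrite in_itv /= => /andP[az zb] E.
have -> : expR ((r + 1) * b) * B.[b] - expR ((r + 1) * a) * B.[a]
     - c * (expR b * A.[b] - expR a * A.[a]) = dphi z * (b - a).
  by rewrite -E /phi; ring.
have M0 : 0 <= M by apply: le_trans (normr_ge0 _) (hM z _); rewrite az.
have ba0 : 0 <= b - a by rewrite subr_ge0.
rewrite normrM (ger0_norm ba0) /dphi !normrM (ger0_norm (expR_ge0 _)).
have rc : expR (r * z) <= c by rewrite ler_expR ler_wpM2l.
rewrite ler0_norm ?subr_le0 // opprB.
have ra : c - expR (r * z) <= c - expR (r * a) by rewrite lerD2l lerN2 ler_expR ler_wpM2l.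
rewrite mulrA; apply: ler_wpM2r => //.
rewrite [leRHS]mulrAC.
apply: ler_pM => //; [by rewrite mulr_ge0 ?expR_ge0 ?subr_ge0| |by rewrite hM ?az].
by apply: ler_pM; rewrite ?subr_ge0 ?expR_ge0 // ler_expR.
Qed.

Lemma le_powR (x y q : R) : 0 <= q -> 0 <= x -> x <= y -> x `^ q <= y `^ q.
Proof.
by move=> q0 x0 xy; apply: ge0_ler_powR; rewrite ?nnegrE //; exact: le_trans xy.
Qed.

Variables (k : nat) (r s K : R) (A B : {poly R}).
Hypothesis r0 : 0 <= r.
Hypothesis s0 : 0 < s.
Hypothesis K0 : 0 <= K.
Hypothesis BA : (r + 1) *: B + B^`() = A + A^`().
Hypothesis TA : forall x, 1 <= x ->
  `|Tsum R k (Num.truncn x) - x * A.[ln x]| <= K * x `^ s.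

Definition twisted_Tsum N : R := \sum_(1 <= n < N.+1) (tau k n)%:R * n%:R `^ r.

Let s00 : 0 <= s. Proof. exact: ltW. Qed.

Let G y := y `^ (r + 1) * B.[ln y].
Let H y := y * A.[ln y].

Lemma powRE (y q : R) : 0 < y -> y `^ q = expR (q * ln y).
Proof. by move=> y0; rewrite /powR gt_eqF. Qed.

(** With [G] and [H] the main terms of the twisted and plain sums, (S - G) - y^r (T - H) is minus
    the integral of T - H against d(t^r), up to a constant; hence its change is controlled by the
    increment of t^r. Arbitrary [S'] and [T'] cover both a step to the next integer, with a jump,
    and a final fractional step without one. *)
Lemma summation_step : exists2 M : R, 0 <= M & forall (m : nat) (y S S' T' : R),
  (0 < m)%N -> m%:R <= y <= m%:R + 1 ->
  S' - S = y `^ r * (T' - Tsum R k m) ->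
  `|(S' - G y - y `^ r * (T' - H y))
     - (S - G m%:R - m%:R `^ r * (Tsum R k m - H m%:R))|
  <= (y `^ r - m%:R `^ r) * (M * y `^ s).
Proof.
have [M M0 hM] := horner_ln_bound (A + A^`()) s0.
exists (2 * M + K); first by rewrite addr_ge0 ?mulr_ge0.
move=> m y S S' T' m0 /andP[my ym] SS.
have m1 : (1 : R) <= m%:R by rewrite ler1n.
have mp : (0 : R) < m%:R by lra.
have y0 : 0 < y by lra.
have y1 : 1 <= y by lra.
have lmy : ln m%:R <= ln y by rewrite ler_ln ?posrE.
have l0 : 0 <= ln (m%:R : R) by apply: ln_ge0.
have rr : m%:R `^ r <= y `^ r by apply: le_powR; rewrite ?ler0n //; try lra.
have bd u : ln m%:R <= u <= ln y -> `|(A + A^`()).[u]| <= M * y `^ s.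
  move=> /andP[u1 u2]; rewrite -[u]expRK; apply: le_trans (hM _ _) _.
    by rewrite -expR0 ler_expR; lra.
  rewrite ler_wpM2l //; apply: le_powR; rewrite ?expR_ge0 //.
  by rewrite -[leRHS]lnK ?posrE // ler_expR.
have := twisted_poly_increment r0 BA lmy bd.
rewrite !lnK ?posrE // -!powRE // -/(G _) -/(G _) -/(H _) -/(H _) => I.
have -> : S' - G y - y `^ r * (T' - H y) - (S - G m%:R - m%:R `^ r * (Tsum R k m - H m%:R))
  = - (G y - G m%:R - y `^ r * (H y - H m%:R)) - (y `^ r - m%:R `^ r) * (Tsum R k m - H m%:R).
  have -> : S' = S + y `^ r * (T' - Tsum R k m) by rewrite -SS addrC subrK.
  by ring.
apply: le_trans (ler_normB _ _) _; rewrite normrN.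
have TE : `|Tsum R k m - H m%:R| <= K * y `^ s.
  have := TA m1; rewrite natrK => /le_trans; apply; rewrite ler_wpM2l //.
  by apply: le_powR; rewrite ?ler0n //; try lra.
rewrite normrM (ger0_norm (_ : 0 <= y `^ r - m%:R `^ r)) ?subr_ge0 //.
(* Here ln(y/m) <= y/m - 1 <= 1/m, and y <= m + 1 <= 2m. *)
have yl : y * (ln y - ln m%:R) <= 2.
  have : ln y - ln m%:R <= y / m%:R - 1.
    rewrite -ln_div ?posrE //; have -> : y / m%:R = 1 + (y / m%:R - 1) by ring.
    have : 0 < y / m%:R by rewrite divr_gt0.
    by move=> ?; apply: le_trans (le_ln1Dx _) _; lra.
  have : y / m%:R - 1 <= m%:R^-1.
    by rewrite lerBlDr ler_pdivrMr // mulrDl mulVf ?gt_eqF // mul1r addrC.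
  move=> h1 h2; have h : ln y - ln m%:R <= m%:R^-1 by lra.
  apply: le_trans (ler_wpM2l (ltW y0) h) _; rewrite ler_pdivrMr //; lra.
have -> : (y `^ r - m%:R `^ r) * ((2 * M + K) * y `^ s) =
  (y `^ r - m%:R `^ r) * (2 * M * y `^ s) + (y `^ r - m%:R `^ r) * (K * y `^ s) by ring.
apply: lerD; last by rewrite ler_wpM2l // subr_ge0.
apply: le_trans I _; rewrite -mulrA ler_wpM2l ?subr_ge0 //.
by rewrite mulrC -mulrA ler_wpM2r // mulr_ge0 ?powR_ge0.
Qed.

Lemma twisted_Tsum_asymp : exists2 K' : R, 0 <= K' & forall y, 1 <= y ->
  `|twisted_Tsum (Num.truncn y) - y `^ (r + 1) * B.[ln y]| <= K' * y `^ (r + s).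
Proof.
have [M M0 hM] := summation_step.
pose D N := twisted_Tsum N - G N%:R - N%:R `^ r * (Tsum R k N - H N%:R).
(* With the factor M X^s uniform in the step, the increments of n^r telescope to N^r - 1. *)
have claim N X : (0 < N)%N -> N%:R <= X ->
    `|D N| <= `|D 1%N| + (N%:R `^ r - 1) * (M * X `^ s).
  case: N => // N _; elim: N => [|N IH] NX; first by rewrite powR1 subrr mul0r addr0.
  have N1 : (0 : R) < N.+1%:R by rewrite ltr0n.
  have N2 : N.+1%:R + 1 = N.+2%:R :> R by rewrite natr1.
  have := IH ltac:(lra).
  have := @hM N.+1 N.+2%:R (twisted_Tsum N.+1) (twisted_Tsum N.+2) (Tsum R k N.+2) isT.
  rewrite -/(D N.+2) -/(D N.+1) => st.
  have {st} : `|D N.+2 - D N.+1| <= (N.+2%:R `^ r - N.+1%:R `^ r) * (M * N.+2%:R `^ s).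
    apply: st; first by apply/andP; split; lra.
    rewrite /twisted_Tsum /Tsum ![\sum_(1 <= n < N.+3) _]big_nat_recr //=.
    by rewrite [\sum_(1 <= i < N.+2) _ + _]addrC addrK [in RHS](addrC (\sum_(_ <= _ < _) _)) addrK mulrC.
  have rr : N.+1%:R `^ r <= N.+2%:R `^ r :> R.
    by apply: le_powR; rewrite ?ler0n //; try lra.
  have ss : M * N.+2%:R `^ s <= M * X `^ s.
    by rewrite ler_wpM2l //; apply: le_powR; rewrite ?ler0n //; try lra.
  have rr0 : 0 <= N.+2%:R `^ r - N.+1%:R `^ r :> R by rewrite subr_ge0.
  have := ler_wpM2l rr0 ss; have := ler_normD (D N.+2 - D N.+1) (D N.+1); rewrite subrK.
  lra.
(* One [M] pays for the integer steps and one for the step from N to y; [K] pays for the boundary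
   term y^r (T - H). *)
exists (`|D 1%N| + 2 * M + K); first by rewrite !addr_ge0 ?mulr_ge0.
move=> y y1; have y0 : 0 < y by lra.
have /andP[Ny yN] := truncn_itv (ltW y0); set N := Num.truncn y in Ny yN *.
have N0 : (0 < N)%N by rewrite -ltnS -(ltr_nat R); apply: le_lt_trans yN.
have c1 := claim N y N0 Ny.
have st : `|(twisted_Tsum N - G y - y `^ r * (Tsum R k N - H y)) - D N|
    <= (y `^ r - N%:R `^ r) * (M * y `^ s).
  apply: hM => //; last by rewrite !subrr mulr0.
  by rewrite Ny natr1 ltW.
have t := TA y1; rewrite -/N -/(H y) in t.
have r1 : 1 <= y `^ r by rewrite -(powRr0 y) ler_powR.
have s1 : 1 <= y `^ s by rewrite -(powRr0 y) ler_powR // ltW.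
have rN : N%:R `^ r <= y `^ r by apply: le_powR; rewrite ?ler0n //; try lra.
rewrite -/(G y) powRD; last by rewrite (gt_eqF y0) implybT.
have -> : twisted_Tsum N - G y = (twisted_Tsum N - G y - y `^ r * (Tsum R k N - H y) - D N)
   + D N + y `^ r * (Tsum R k N - H y) by ring.
apply: le_trans (ler_normD _ _) _.
have := ler_normD (twisted_Tsum N - G y - y `^ r * (Tsum R k N - H y) - D N) (D N).
have r00 : 0 <= y `^ r by lra.
have h4 : `|y `^ r * (Tsum R k N - H y)| <= y `^ r * (K * y `^ s).
  by rewrite normrM (ger0_norm r00) ler_wpM2l.
have h5 : `|D 1%N| <= `|D 1%N| * (y `^ r * y `^ s).
  by rewrite ler_peMr // mulr_ege1.
have h6 : (N%:R `^ r - 1) * (M * y `^ s) <= y `^ r * (M * y `^ s).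
  by rewrite ler_wpM2r ?mulr_ge0 ?powR_ge0 //; lra.
have h7 : (y `^ r - N%:R `^ r) * (M * y `^ s) <= y `^ r * (M * y `^ s).
  rewrite ler_wpM2r ?mulr_ge0 ?powR_ge0 //; have := powR_ge0 N%:R r; lra.
lra.
Qed.
End PartialSummation.

(** * The multiplicative factor g *)

Lemma lcm_conv_unit (A : comNzRingType) (f : nat -> A) k c : lcm_conv f k c 1 = f c.
Proof. by elim: k c => // k IH c /=; rewrite big_seq1 IH lcmn1. Qed.

(** In a factorization of p exactly one of the k entries is p, and the lcm is then p. *)
Lemma lcm_conv_prime (A : comNzRingType) (f : nat -> A) k p : prime p ->
  lcm_conv f k 1 p = k%:R * f p.
Proof.
move=> pp; have p0 := prime_gt0 pp.
elim: k => [|k IH] /=; first by rewrite mul0r gtn_eqF // prime_gt1.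
rewrite -{1}(expn1 p) big_divisors_pfactor // big_ord_recl big_ord1 /=.
rewrite /bump /= expn0 divn1 !expn1 lcm1n IH.
rewrite lcm1n divnn p0 lcm_conv_unit -natr1 mulrDl mul1r.
by [].
Qed.

Section Deconvolution.
Variables (R : realType) (r : R) (f : nat -> R[i]) (k : nat).
Hypothesis r0 : 0 <= r.
Hypothesis hf : class_A r f.

Definition power_fun n : R[i] := (n%:R `^ r)%:C.
Local Notation J := power_fun.

Lemma power_fun1 : J 1%N = 1.
Proof. by rewrite /J powR1. Qed.

Lemma power_funM m n : (0 < m)%N -> (0 < n)%N -> J (m * n)%N = J m * J n.
Proof. by move=> _ _; rewrite /J natrM powRM ?ler0n // rmorphM. Qed.

Definition lcm_fun n : R[i] := lcm_conv f k 1 n.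
Local Notation F := lcm_fun.
(** The function g: its Dirichlet series is that of F divided by zeta(s - r)^k. *)
Definition residual n : R[i] := iter k (twist_inv J) F n.
Local Notation g := residual.

Lemma lcm_fun_mult : mult_fun F.
Proof.
have fm : mult_fun f by case: hf.
split=> [|m n m0 n0 cop]; first by rewrite /F lcm_conv_unit; case: fm.
by rewrite /F -{1}(muln1 1%N) lcm_convM // !muln1.
Qed.

Lemma iter_twist_inv_mult m : mult_fun (iter m (twist_inv J) F).
Proof. case: m => [|m]; [exact: lcm_fun_mult | exact: twist_inv_mult]. Qed.

Lemma residual_mult : mult_fun g.
Proof. exact: iter_twist_inv_mult. Qed.

Lemma lcm_fun_residual n : (0 < n)%N ->
  F n = \sum_(d <- divisors n) g d * ((tau k (n %/ d))%:R * J (n %/ d)%N).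
Proof.
move=> n0; rewrite -(iter_twist_sum_tau power_fun1 power_funM) //.
by rewrite (iter_twist_sumK power_fun1 power_funM) //; exact: lcm_fun_mult.
Qed.

Lemma powR_natX (x : R) (v : nat) : 0 <= x -> x `^ (v%:R * r) = (x `^ r) ^+ v.
Proof. by move=> x0; rewrite mulrC powRrM powR_mulrn ?powR_ge0. Qed.

Lemma power_fun_ge1 p : prime p -> 1 <= (p%:R : R) `^ r.
Proof.
move=> pp; rewrite -[leLHS](powRr0 p%:R) ler_powR // ler1n; exact: prime_gt0.
Qed.

Lemma f_pfactor_bound : exists2 c : R, 1 <= c & forall p v, prime p ->
  nrm (f (p ^ v)%N) <= c * (p%:R `^ r) ^+ v.
Proof.
have [[f1 _] [C1 [C2 [h1 h2]]]] := hf.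
have n1 := normr_ge0 C1; have n2 := normr_ge0 C2.
exists (1 + `|C1| + `|C2|); first by lra.
move=> p v pp; have x1 := power_fun_ge1 pp.
have p1 : (1 : R) <= p%:R by rewrite ler1n prime_gt0.
case: v => [|[|v]].
- by rewrite expn0 f1 nrm1 expr0; lra.
- rewrite expn1 expr1; have := h1 _ pp; rewrite normcE lecR => h.
  have h3 : C1 * p%:R `^ (r - 1 / 2) <= `|C1| * p%:R `^ r.
    apply: le_trans (_ : _ <= `|C1| * p%:R `^ (r - 1 / 2)) _.
      by rewrite ler_wpM2r ?powR_ge0 // ler_norm.
    by rewrite ler_wpM2l // ler_powR //; lra.
  have := ler_nrmD (f p - (p%:R `^ r)%:C) (p%:R `^ r)%:C.
  rewrite subrK nrmC ger0_norm ?powR_ge0 // => h4.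
  have : 0 <= `|C2| * p%:R `^ r by rewrite mulr_ge0 ?powR_ge0.
  by rewrite !mulrDl mul1r; lra.
- have := h2 p v.+2 pp isT; rewrite normcE lecR powR_natX ?ler0n // => /le_trans; apply.
  rewrite ler_wpM2r ?exprn_ge0 ?powR_ge0 //; have := ler_norm C2; lra.
Qed.

(** One more entry costs the sum of (6/5)^l over l <= j, which is at most 6 (6/5)^j; this trades the
    polynomial number of tuples for a mild exponential. The powers of p^r fit because max(i, l) + (j
    - l) <= i + j. *)
Lemma lcm_conv_pfactor_bound : exists2 c : R, 1 <= c & forall m p i j, prime p ->
  nrm (lcm_conv f m (p ^ i) (p ^ j)) <= c * 6 ^+ m * (6 / 5) ^+ j * (p%:R `^ r) ^+ (i + j).
Proof.
have [c c1 hc] := f_pfactor_bound; exists c => // m p i j pp.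
have x1 := power_fun_ge1 pp; set x := p%:R `^ r in x1 *.
have p1 := prime_gt1 pp.
have cm n : 0 <= c * 6 ^+ n by rewrite mulr_ge0 ?exprn_ge0 //; lra.
elim: m i j => [|m IH] i j /=.
  rewrite -[X in _ == X](expn0 p) eqn_exp2l //; case: eqP => [->|_].
    by rewrite expr0 !mulr1 addn0; exact: hc.
  by rewrite nrm0 !mulr_ge0 ?exprn_ge0 //; lra.
rewrite big_divisors_pfactor //; apply: le_trans (ler_nrm_sum _ _ _) _.
apply: le_trans (_ : _ <= \sum_(l < j.+1) c * 6 ^+ m * x ^+ (i + j) * (6 / 5) ^+ l) _.
  rewrite [leRHS](reindex_inj rev_ord_inj) /=; apply: ler_sum => l _.
  have lj : (l <= j)%N by rewrite -ltnS.
  rewrite -expn_max -expnB ?(ltnW p1) //; apply: le_trans (IH _ _) _.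
  rewrite subSS mulrAC ler_wpM2r ?exprn_ge0 //.
  rewrite ler_wpM2l // ler_weXn2l //; lia.
rewrite -big_distrr /= exprS.
have -> : c * (6 * 6 ^+ m) * (6 / 5) ^+ j * x ^+ (i + j) = c * 6 ^+ m * x ^+ (i + j) * (6 * (6 / 5) ^+ j) by ring.
rewrite ler_wpM2l //; first by rewrite mulr_ge0 ?exprn_ge0 //; lra.
elim: j {IH} => [|j IHj]; first by rewrite big_ord1 !expr0; lra.
by rewrite big_ord_recr /= [in leRHS]exprS; move: IHj; rewrite !exprS; lra.
Qed.

(** Each division subtracts a term of no larger bound, since p^r <= (6/5) p^r, so the constant at
    most doubles. *)
Lemma iter_twist_inv_bound : exists2 c : R, 1 <= c & forall m p v, prime p ->
  nrm (iter m (twist_inv J) F (p ^ v)%N) <= c * 2 ^+ m * ((6 / 5) * p%:R `^ r) ^+ v.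
Proof.
have [c c1 hc] := lcm_conv_pfactor_bound.
have c6 : 1 <= c * 6 ^+ k by rewrite mulr_ege1 // exprn_ege1 //; lra.
exists (c * 6 ^+ k) => // m p v pp; have x1 := power_fun_ge1 pp.
elim: m v => [|m IH] v.
  rewrite expr0 mulr1 exprMn mulrA /=; have := hc k p 0%N v pp.
  by rewrite expn0 add0n.
case: v => [|v].
  rewrite expn0 (proj1 (iter_twist_inv_mult m.+1)) nrm1 expr0 mulr1.
  by rewrite mulr_ege1 // exprn_ege1 //; lra.
rewrite iterS twist_inv_pfactor //; apply: le_trans (ler_nrmB _ _) _.
rewrite nrmM nrmC ger0_norm ?powR_ge0 //.
have := IH v.+1; have := IH v; set a := nrm _; set b := nrm _; set x := p%:R `^ r in x1 *.
set y := 6 / 5 * x; set D := c * 6 ^+ k * 2 ^+ m => h1 h2.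
have -> : c * 6 ^+ k * 2 ^+ m.+1 * y ^+ v.+1 = D * y ^+ v.+1 + D * y ^+ v.+1.
  by rewrite /D [2 ^+ m.+1]exprS; ring.
apply: lerD => //.
have x0 : 0 <= x by lra.
apply: le_trans (ler_wpM2l x0 h1) _.
have D0 : 0 <= D * y ^+ v.
  by rewrite /D /y !mulr_ge0 ?exprn_ge0 ?mulr_ge0 //; lra.
have -> : D * y ^+ v.+1 = (D * y ^+ v) * y by rewrite exprS; ring.
by rewrite mulrC ler_wpM2l // /y; lra.
Qed.

Lemma residual_pfactor_bound : exists2 c : R, 1 <= c & forall p v, prime p ->
  nrm (g (p ^ v)%N) <= c * ((6 / 5) * p%:R `^ r) ^+ v.
Proof.
have [c c1 hc] := iter_twist_inv_bound; exists (c * 2 ^+ k) => [|p v pp].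
  by rewrite mulr_ege1 // exprn_ege1 //; lra.
exact: hc.
Qed.

(** Each division removes one p^r from F(p) = k f(p). This cancellation moves the abscissa of
    absolute convergence from r + 1 to r + 1/2. *)
Lemma residual_prime p : prime p -> g p = k%:R * (f p - J p).
Proof.
move=> pp; have FE : F p = k%:R * f p by exact: lcm_conv_prime.
have E m : iter m (twist_inv J) F p = F p - m%:R * J p.
  elim: m => [|m IH]; first by rewrite mul0r subr0.
  rewrite iterS -{1}(expn1 p) twist_inv_pfactor // expn0 expn1 IH.
  by rewrite (proj1 (iter_twist_inv_mult m)) mulr1 -natr1; ring.
by rewrite /g E FE mulrBr.
Qed.

Lemma residual_prime_bound : exists2 c : R, 0 <= c & forall p, prime p ->
  nrm (g p) <= c * p%:R `^ (r - 1 / 2).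
Proof.
have [_ [C1 [C2 [h1 _]]]] := hf.
exists (k%:R * `|C1|) => [|p pp]; first by rewrite mulr_ge0 ?ler0n.
rewrite residual_prime // nrmM -(rmorph_nat (real_complex R)) nrmC ger0_norm ?ler0n //.
rewrite -mulrA ler_wpM2l ?ler0n //; have := h1 _ pp; rewrite normcE lecR => /le_trans; apply.
by rewrite ler_wpM2r ?powR_ge0 // ler_norm.
Qed.

Lemma residual_euler_factor_bound s : r + 1 / 2 < s -> exists2 K : R, 0 <= K &
  forall p V, prime p ->
  \sum_(0 <= v < V) nrm (g (p ^ v)%N) * (p ^ v)%:R `^ (- s)
    <= 1 + K * p%:R `^ (- (1 + (s - r - 1 / 2))).
Proof.
move=> rs; have [c c1 hc] := residual_pfactor_bound; have [d d0 hd] := residual_prime_bound.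
(* [d] pays for v = 1. The terms v >= 2 form a geometric series with first term at most (36/25) c w
   and ratio at most 6/7, hence at most (36/25) 7 c w < 11 c w. *)
exists (d + 11 * c) => [|p V pp]; first by rewrite addr_ge0 ?mulr_ge0 //; lra.
have p1 : (1 : R) <= p%:R by rewrite ler1n prime_gt0.
have p2 : (2 : R) <= p%:R by rewrite ler_nat prime_gt1.
have p0 : (0 : R) < p%:R by lra.
pose z : R := p%:R `^ (- (s - r)); pose w : R := p%:R `^ (- (1 + (s - r - 1 / 2))).
have z0 : 0 < z by rewrite powR_gt0.
have w0 : 0 < w by rewrite powR_gt0.
have zz : z ^+ 2 <= w.
  by rewrite -(powR_mulrn _ (ltW z0)) -powRrM ler_powR //; lra.
have w2 : w <= 1 / 2.
  apply: le_trans (_ : _ <= p%:R `^ (-1)) _; first by rewrite ler_powR //; lra.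
  by rewrite (powR_inv1 (ltW p0)) div1r lef_pV2 ?posrE.
(* z^2 <= w <= 1/2 gives z <= 5/7, because 25/49 > 1/2. *)
have z57 : 6 / 5 * z <= 6 / 7 by nra.
have term v : nrm (g (p ^ v)%N) * (p ^ v)%:R `^ (- s) <= c * (6 / 5 * z) ^+ v.
  apply: le_trans (ler_wpM2r (powR_ge0 _ _) (hc _ v pp)) _.
  have -> : z = p%:R `^ r * p%:R `^ (- s).
    by rewrite /z -powRD ?(gt_eqF p0) ?implybT //; congr (_ `^ _); ring.
  have -> : (p ^ v)%:R `^ (- s) = (p%:R `^ (- s)) ^+ v.
    by rewrite natrX -(powR_mulrn _ (ltW p0)) -powRrM mulrC powRrM powR_mulrn ?powR_ge0.
  by rewrite mulrA [in leRHS]exprMn mulrA.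
have bnd : \sum_(2 <= v < V) c * (6 / 5 * z) ^+ v <= 11 * c * w.
  rewrite -big_distrr /= !big_add1.
  under eq_bigr => i _ do rewrite !exprS.
  under eq_bigr => i _ do rewrite mulrA.
  rewrite -big_distrr /=.
  have q01 : 0 <= 6 / 5 * z < 1 by apply/andP; split; lra.
  have := geometric_sum_le V.-2 q01; set S := \sum_(0 <= i < _) _ => h.
  have S7 : S <= 7.
    apply: le_trans h _; rewrite -[leRHS]invrK lef_pV2 ?posrE; [lra|lra|].
    by rewrite invr_gt0.
  have S0 : 0 <= S by apply: sumr_ge0 => i _; rewrite exprn_ge0; lra.
  have h2 : (6 / 5 * z) * (6 / 5 * z) * S <= 36 / 25 * w * 7.
    apply: ler_pM => //; first by rewrite mulr_ge0; lra.
    by move: zz; rewrite expr2; lra.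
  have := ler_wpM2l (le_trans ler01 c1) h2.
  have : 0 <= c * w by rewrite mulr_ge0 ?(ltW w0) //; lra.
  lra.
have t0 v : 0 <= c * (6 / 5 * z) ^+ v by rewrite mulr_ge0 ?exprn_ge0 //; lra.
have dw : 0 <= (d + 11 * c) * w by rewrite mulr_ge0 ?(ltW w0) // addr_ge0 ?mulr_ge0 //; lra.
have g1 : nrm (g (p ^ 0)%N) * (p ^ 0)%:R `^ (- s) = 1.
  by rewrite expn0 powR1 (proj1 residual_mult) nrm1 mulr1.
rewrite -/w; case: V bnd => [|[|V]] bnd; first by rewrite big_geq //; lra.
  by rewrite big_nat1 g1; lra.
rewrite big_ltn // g1 lerD2l big_ltn // mulrDl; apply: lerD.
  rewrite !expn1; apply: le_trans (ler_wpM2r (powR_ge0 _ _) (hd _ pp)) _.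
  rewrite -mulrA -powRD ?(gt_eqF p0) ?implybT // ler_wpM2l // ler_powR //; lra.
by apply: le_trans bnd; apply: ler_sum => v _; exact: term.
Qed.

Lemma residual_abs_sum s : r + 1 / 2 < s -> exists2 M : R, 0 <= M & forall N,
  \sum_(1 <= n < N) nrm (g n) * n%:R `^ (- s) <= M.
Proof.
move=> rs; have [K K0 hK] := residual_euler_factor_bound rs.
pose b := s - r - 1 / 2; have b0 : 0 < b by rewrite /b; lra.
pose h n : R := nrm (g n) * n%:R `^ (- s).
have h0 n : 0 <= h n by rewrite mulr_ge0 ?nrm_ge0 ?powR_ge0.
have hm : mult_fun h.
  have [g1 gM] := residual_mult; split=> [|m n m0 n0 cop].
    by rewrite /h g1 nrm1 powR1 mulr1.
  by rewrite /h gM // nrmM natrM powRM ?ler0n // mulrACA.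
exists (expR (K * (1 + b^-1))) => [|N]; first exact: expR_ge0.
(* A number below N has all its prime factors and all its exponents below N, so it occurs in this
   list. *)
apply: le_trans (_ : _ <= \sum_(n <- smooth N N) h n) _.
  apply: ler_sum_uniq => // [||n]; [exact: iota_uniq|exact: smooth_uniq|].
  rewrite mem_index_iota => /andP[n1 nN]; apply: mem_smooth => //.
    exact: leq_ltn_trans nN.
  move=> p pp pn; split; first exact: leq_ltn_trans (dvdn_leq n1 pn) nN.
  apply: leq_ltn_trans nN; apply: leq_trans (dvdn_leq n1 (pfactor_dvdnn p n)).
  by rewrite ltnW // ltn_expl // prime_gt1.
rewrite -(prod_sum_smooth _ _ hm).
apply: le_trans (_ : _ <= \prod_(0 <= p < N | prime p) expR (K * p%:R `^ (- (1 + b)))) _.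
  apply: ler_prod => p pp; rewrite sumr_ge0 //=.
  by apply: le_trans (hK _ _ pp) _; exact: expR_ge1Dx.
rewrite -expR_sum ler_expR -big_distrr /= ler_wpM2l //.
apply: le_trans (sum_powR_le N b0).
case: N => [|N]; first by rewrite !big_geq.
rewrite big_ltn_cond //= big_mkcond /=; apply: ler_sum => n _.
by case: ifP => // _; rewrite powR_ge0.
Qed.
End Deconvolution.

(** * The Euler product *)

Section Cube.
Variable k : nat.

Definition cube V : seq {ffun 'I_k -> nat} :=
  [seq [ffun i => nat_of_ord (t i)] | t : {ffun 'I_k -> 'I_V}].

Lemma cube_uniq V : uniq (cube V).
Proof.
rewrite map_inj_uniq ?enum_uniq // => s t /ffunP E; apply/ffunP => i; apply: val_inj.
by have := E i; rewrite !ffunE.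
Qed.

Lemma mem_cube V nu : (nu \in cube V) = [forall i, (nu i < V)%N].
Proof.
apply/mapP/forallP => [[t _ ->] i|h]; first by rewrite ffunE.
exists [ffun i => Ordinal (h i)]; rewrite ?mem_enum //.
by apply/ffunP => i; rewrite !ffunE.
Qed.

Lemma sum_cube (M : nmodType) V (P : pred {ffun 'I_k -> nat}) (G : {ffun 'I_k -> nat} -> M) :
  \sum_(nu <- cube V | P nu) G nu
  = \sum_(t : {ffun 'I_k -> 'I_V} | P [ffun i => nat_of_ord (t i)]) G [ffun i => nat_of_ord (t i)].
Proof. by rewrite /cube big_map big_enum_cond; apply: eq_bigl. Qed.

Variable R : realType.

(** The finite set is enclosed in a cube, over which the sum factors into k geometric sums. *)
Lemma geometric_multisum_le (q : R) (s : seq {ffun 'I_k -> nat}) : 0 <= q < 1 -> uniq s ->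
  \sum_(nu <- s) q ^+ (\sum_(i < k) nu i) <= (1 - q)^-1 ^+ k.
Proof.
move=> q01 us; have /andP[q0 q1] := q01.
pose V := (\max_(nu <- s) \max_(i < k) nu i).+1.
apply: le_trans (_ : _ <= \sum_(nu <- cube V) q ^+ (\sum_(i < k) nu i)) _.
  apply: ler_sum_uniq => //; [by move=> nu; rewrite exprn_ge0|exact: cube_uniq|].
  move=> nu ns; rewrite mem_cube; apply/forallP => i; rewrite ltnS.
  apply: leq_trans (leq_bigmax i) _.
  exact: (@leq_bigmax_seq _ s xpredT (fun nu : {ffun 'I_k -> nat} => \max_(i < k) nu i) nu ns isT).
rewrite sum_cube.
have -> : \sum_(t : {ffun 'I_k -> 'I_V}) q ^+ (\sum_(i < k) [ffun i => nat_of_ord (t i)] i)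
   = \prod_(i < k) \sum_(j < V) q ^+ j.
  rewrite bigA_distr_bigA /=; apply: eq_bigr => t _.
  rewrite -expr_sum; congr (_ ^+ _); apply: eq_bigr => i _; by rewrite ffunE.
rewrite prodr_const card_ord; apply: lerXn2r; rewrite ?nnegrE.
- by apply: sumr_ge0 => i _; rewrite exprn_ge0.
- by rewrite invr_ge0; lra.
by rewrite -(big_mkord predT (fun j => q ^+ j)); exact: geometric_sum_le.
Qed.
End Cube.

(** * Local factors and their product C *)

Section EulerConstant.
Variables (R : realType) (r : R) (f : nat -> R[i]) (k : nat).
Hypothesis r0 : 0 <= r.
Hypothesis hf : class_A r f.
Local Notation J := (power_fun r).
Local Notation F := (lcm_fun f k).
Local Notation g := (residual r f k).

Definition local_ratio p : R[i] := (p%:R `^ (- (r + 1)))%:C.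
Local Notation q := local_ratio.

Lemma euler_termE p (nu : {ffun 'I_k -> nat}) : prime p ->
  euler_term f r p nu = f (p ^ \max_(i < k) nu i)%N * q p ^+ (\sum_(i < k) nu i)%N.
Proof.
move=> pp; rewrite /euler_term; congr (_ * _).
rewrite /q -rmorphXn -fmorphV; congr (_%:C).
by rewrite -powRN -mulNr powRrM powR_mulrn ?powR_ge0.
Qed.

Lemma power_fun_ratio p : prime p -> J p * q p = (p%:R^-1)%:C.
Proof.
move=> pp; rewrite /power_fun /q -rmorphM; congr (_%:C).
have p0 : (0 : R) < p%:R by rewrite ltr0n prime_gt0.
rewrite -powRD ?(gt_eqF p0) ?implybT // -powR_inv1 ?ltW //.
by congr (_ `^ _); ring.
Qed.

Lemma ratio_bound p : prime p -> p%:R `^ r * nrm (q p) <= 1 / 2.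
Proof.
move=> pp; have p2 : (2 : R) <= p%:R by rewrite ler_nat prime_gt1.
have -> : p%:R `^ r = nrm (J p) by rewrite nrmC ger0_norm ?powR_ge0.
rewrite -nrmM power_fun_ratio // nrmC ger0_norm ?invr_ge0 ?ler0n //.
by rewrite div1r lef_pV2 ?posrE //; lra.
Qed.

(** The tuples are grouped by their sum v. Entries never exceed the sum, so the cube of side N
    contains every tuple of sum below N. *)
Lemma sum_lcm_fun_pfactor p N : prime p ->
  \sum_(nu <- cube k N | (\sum_(i < k) nu i < N)%N) euler_term f r p nu
  = \sum_(0 <= v < N) F (p ^ v)%N * q p ^+ v.
Proof.
move=> pp; rewrite sum_cube big_mkord.
transitivity (\sum_(v < N) \sum_(t : {ffun 'I_k -> 'I_N} | (\sum_(i < k) t i)%N == v)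
    f (p ^ maxn 0 (\max_(i < k) t i))%N * q p ^+ v); last first.
  apply: eq_bigr => v _; rewrite -big_distrl /= lcm_conv_pfactor // expn0 //.
rewrite (exchange_big_dep (fun t : {ffun 'I_k -> 'I_N} => (\sum_(i < k) t i < N)%N)) /=; last first.
  by move=> v t _ /eqP ->.
apply: eq_big => [t|t tN].
  by congr (_ < _)%N; apply: eq_bigr => i _; rewrite ffunE.
have tN' : (\sum_(i < k) t i < N)%N.
  by move: tN; rewrite (eq_bigr (fun i => nat_of_ord (t i))) // => i _; rewrite ffunE.
rewrite (eq_bigl (fun v => v == Ordinal tN')); last first.
  by move=> v; rewrite /= -val_eqE eq_sym.
rewrite big_pred1_eq euler_termE // max0n /=; congr (f (_ ^ _)%N * _ ^+ _).
  by apply: eq_bigr => i _; rewrite ffunE.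
by apply: eq_bigr => i _; rewrite ffunE.
Qed.

Lemma small_geometric (x e : R) : 0 <= x < 1 -> 0 < e -> exists N, x ^+ N <= e.
Proof.
move=> x01 e0; have /andP[x0 _] := x01.
have [N hN] := bounded_series_tail (fun n => exprn_ge0 n x0)
  (fun N => geometric_sum_le N x01) e0.
exists N; have := hN [:: N] isT; rewrite big_seq1; apply.
by move=> n; rewrite inE => /eqP ->.
Qed.

(** As p^r >= 1 and the maximum is at most the sum m, the term is O((p^r p^(-r-1))^m) =
    O(p^(-m)). *)
Lemma euler_term_bound : exists2 c : R, 1 <= c & forall p (nu : {ffun 'I_k -> nat}), prime p ->
  nrm (euler_term f r p nu) <= c * (1 / 2) ^+ (\sum_(i < k) nu i)%N.
Proof.
have [c c1 hc] := f_pfactor_bound r0 hf; exists c => // p nu pp.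
have x1 := power_fun_ge1 r0 pp.
set m := (\sum_(i < k) nu i)%N; rewrite euler_termE // nrmM.
rewrite nrmX; apply: le_trans (ler_wpM2r _ (hc _ _ pp)) _; first by rewrite exprn_ge0 ?nrm_ge0.
rewrite -mulrA ler_wpM2l //; first lra.
apply: le_trans (_ : _ <= (p%:R `^ r * nrm (q p)) ^+ m) _.
  rewrite exprMn ler_wpM2r ?exprn_ge0 ?nrm_ge0 // ler_weXn2l //.
  by apply/bigmax_leqP => i _; rewrite /m (bigD1 i) //= leq_addr.
by apply: lerXn2r; rewrite ?nnegrE ?mulr_ge0 ?powR_ge0 ?nrm_ge0 ?ratio_bound.
Qed.

(** A finite set containing the cube of side N splits into the tuples of sum below N, whose total is
    exactly the N-th partial sum of the local series, and tuples of sum at least N, whose total is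
    small. *)
Lemma csum_to_lcm_fun p E : prime p ->
  tends (fun N => \sum_(0 <= v < N) F (p ^ v)%N * q p ^+ v) E ->
  csum_to (@euler_term R f r k p) E.
Proof.
move=> pp tE; have [c c1 hc] := euler_term_bound.
suff main (e : R) : 0 < e -> exists N, forall s : seq {ffun 'I_k -> nat}, uniq s ->
    {subset cube k N <= s} -> nrm (\sum_(nu <- s) euler_term f r p nu - E) <= e.
  have ? : Filter (@totally {ffun 'I_k -> nat}) by have [] := @totally_filter {ffun 'I_k -> nat}.
  apply/cvgrPdist_le => e e0.
  have e0' : 0 < complex.Re e by move: e0; rewrite ltcE => /andP[].
  have [N hN] := main _ e0'.
  exists (seq_fset tt (cube k N)) => // A /= /fsubsetP sA.
  rewrite -normrN opprB normcE /partial_sum -(big_seq_fsetE _ _ predT) /=.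
  have -> : e = (complex.Re e)%:C.
    by move: e0; rewrite ltcE => /andP[/eqP]; case: (e) => a b /= -> _.
  rewrite lecR; apply: hN; first exact: fset_uniq.
  move=> nu hnu; have h : nu \in seq_fset tt (cube k N) by rewrite seq_fsetE.
  exact: sA h.
move=> e0; have e2 : 0 < e / 2 by lra.
have [N1 hN1] := tE _ e2.
(* The decay is split as 1/2 = (2/3)(3/4): powers of 2/3 make the remainder small, powers of 3/4
   keep it summable over all tuples. *)
have W0 : 0 < c * (1 - 3 / 4 : R)^-1 ^+ k.
  by rewrite mulr_gt0 ?exprn_gt0 ?invr_gt0; lra.
have [|N2 hN2] := @small_geometric (2 / 3) (e / 2 / (c * (1 - 3 / 4 : R)^-1 ^+ k)) _ (divr_gt0 e2 W0).
  by apply/andP; split; lra.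
exists (maxn N1 N2) => s us; set N := maxn N1 N2 => cs.
rewrite (bigID (fun nu : {ffun 'I_k -> nat} => (\sum_(i < k) nu i < N)%N)) /=.
have -> : \sum_(nu <- s | (\sum_(i < k) nu i < N)%N) euler_term f r p nu
   = \sum_(0 <= v < N) F (p ^ v)%N * q p ^+ v.
  rewrite -sum_lcm_fun_pfactor // -[LHS]big_filter -[RHS]big_filter.
  apply: perm_big; apply: uniq_perm; rewrite ?filter_uniq ?cube_uniq //.
  move=> nu; rewrite !mem_filter; case: ltnP => //= h.
  have nuc : nu \in cube k N.
    rewrite mem_cube; apply/forallP => i; apply: leq_ltn_trans h.
    by rewrite (bigD1 i) //= leq_addr.
  by rewrite nuc cs.
set S1 := \sum_(0 <= v < N) _; set S2 := \sum_(nu <- s | _) _.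
have -> : S1 + S2 - E = (S1 - E) + S2 by ring.
apply: le_trans (ler_nrmD _ _) _.
have h1 : nrm (S1 - E) <= e / 2 by apply: hN1; rewrite leq_maxl.
suff : nrm S2 <= e / 2 by lra.
apply: le_trans (ler_nrm_sum _ _ _) _.
apply: le_trans (_ : _ <= \sum_(nu <- s | ~~ (\sum_(i < k) nu i < N)%N)
   c * (2 / 3) ^+ N2 * (3 / 4) ^+ (\sum_(i < k) nu i)%N) _.
  apply: ler_sum => nu; rewrite -leqNgt => Nm; apply: le_trans (hc _ _ pp) _.
  set m := (\sum_(i < k) nu i)%N in Nm *.
  rewrite -mulrA ler_wpM2l //; first lra.
  have -> : (1 / 2 : R) = (2 / 3) * (3 / 4) by lra.
  rewrite exprMn ler_wpM2r ?exprn_ge0 //.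
  apply: ler_wiXn2l; [lra|lra|]; apply: leq_trans Nm; exact: leq_maxr.
rewrite -big_filter -big_distrr /=.
have q34 : 0 <= (3 / 4 : R) < 1 by apply/andP; split; lra.
have := geometric_multisum_le q34 (filter_uniq (fun nu : {ffun 'I_k -> nat} => ~~ (\sum_(i < k) nu i < N)%N) us).
set W := (1 - 3 / 4)^-1 ^+ k in hN2 W0 * => hW.
have cN0 : 0 <= c * (2 / 3 : R) ^+ N2 by rewrite mulr_ge0 ?exprn_ge0; lra.
apply: le_trans (ler_wpM2l cN0 hW) _.
by move: hN2; rewrite ler_pdivlMr //; lra.
Qed.

Lemma euler_factor_exists p : prime p ->
  exists E, tends (fun N => \sum_(0 <= v < N) F (p ^ v)%N * q p ^+ v) E.
Proof.
move=> pp; have [c c1 hc] := lcm_conv_pfactor_bound r0 hf.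
have x1 := power_fun_ge1 r0 pp; have hq := ratio_bound pp.
have q0 : 0 <= p%:R `^ r * nrm (q p) by rewrite mulr_ge0 ?powR_ge0 ?nrm_ge0.
(* The ratio 3/5 is (6/5)(1/2): growth of F(p^v) / p^(rv) against 1/p <= 1/2. *)
have q01 : 0 <= (3 / 5 : R) < 1 by apply/andP; split; lra.
have c0 : 0 <= c * 6 ^+ k by rewrite mulr_ge0 ?exprn_ge0 //; lra.
apply: (@abs_series_tends _ _ (c * 6 ^+ k * (1 - 3 / 5)^-1)) => N.
apply: le_trans (ler_wpM2l c0 (geometric_sum_le N q01)).
rewrite big_distrr /=; apply: ler_sum => v _; rewrite nrmM.
have := hc k p 0%N v pp; rewrite expn0 add0n -/(lcm_fun f k _) => h.
rewrite nrmX; apply: le_trans (ler_wpM2r (exprn_ge0 _ (nrm_ge0 _)) h) _.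
rewrite -[leLHS]mulrA -exprMn -[leLHS]mulrA -exprMn; apply: ler_wpM2l => //.
by apply: lerXn2r; rewrite ?nnegrE; lra.
Qed.

(** The division multiplies the local power series by 1 - p^r p^(-r-1) = 1 - 1/p; on partial sums it
    subtracts 1/p times the sum shifted by one. *)
Lemma twist_inv_series (h : nat -> R[i]) p L : h 1%N = 1 -> prime p ->
  tends (fun N => \sum_(0 <= v < N) h (p ^ v)%N * q p ^+ v) L ->
  tends (fun N => \sum_(0 <= v < N) twist_inv J h (p ^ v)%N * q p ^+ v)
    ((1 - p%:R^-1) * L).
Proof.
move=> h1 pp tL.
have E N : \sum_(0 <= v < N) twist_inv J h (p ^ v)%N * q p ^+ v
  = \sum_(0 <= v < N) h (p ^ v)%N * q p ^+ v
    + - p%:R^-1 * \sum_(0 <= v < (N - 1)%N) h (p ^ v)%N * q p ^+ v.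
  case: N => [|N]; first by rewrite !big_geq // mulr0 addr0.
  rewrite subn1 /= !big_nat_recl //= !expr0 !mulr1 expn0 h1.
  rewrite (proj1 (twist_inv_mult _ _)) -addrA; congr (_ + _).
  have -> : p%:R^-1 = J p * q p by rewrite power_fun_ratio // fmorphV rmorph_nat.
  rewrite mulNr big_distrr /= -sumrB; apply: eq_bigr => v _.
  by rewrite twist_inv_pfactor // exprS; ring.
under eq_fun do rewrite E.
rewrite mulrBl mul1r -mulNr; apply: tendsD => //.
by apply: tendsM; [exact: tends_cst | exact: (tends_shift 1 tL)].
Qed.

Lemma residual_series p E : prime p ->
  tends (fun N => \sum_(0 <= v < N) F (p ^ v)%N * q p ^+ v) E ->
  tends (fun N => \sum_(0 <= v < N) g (p ^ v)%N * q p ^+ v) ((1 - p%:R^-1) ^+ k * E).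
Proof.
move=> pp tE; suff H m : tends (fun N => \sum_(0 <= v < N)
    iter m (twist_inv J) F (p ^ v)%N * q p ^+ v) ((1 - p%:R^-1) ^+ m * E) by exact: H.
elim: m => [|m IH]; first by rewrite expr0 mul1r.
rewrite exprS -mulrA; apply: twist_inv_series => //.
by case: (iter_twist_inv_mult k hf m).
Qed.

Definition residual_term n : R[i] := g n * (n%:R `^ (- (r + 1)))%:C.

Lemma residual_term_mult : mult_fun residual_term.
Proof.
have [g1 gM] := residual_mult k hf; split=> [|m n m0 n0 cop].
  by rewrite /residual_term g1 powR1 mulr1.
by rewrite /residual_term gM // natrM powRM ?ler0n // rmorphM mulrACA.
Qed.

Lemma residual_term_pfactor p v : residual_term (p ^ v)%N = g (p ^ v)%N * q p ^+ v.
Proof.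
rewrite /residual_term /q -rmorphXn; congr (_ * _%:C).
by rewrite natrX -!powR_mulrn ?powR_ge0 ?ler0n // -!powRrM mulrC.
Qed.

Lemma nrm_residual_term n : nrm (residual_term n) = nrm (g n) * n%:R `^ (- (r + 1)).
Proof. by rewrite nrmM nrmC ger0_norm ?powR_ge0. Qed.

(** By the convention that 0 to a nonzero power is 0; hence sums may start at index 0 although g is
    only meaningful from 1 on. *)
Lemma residual_term0 : residual_term 0 = 0.
Proof.
rewrite /residual_term powR0 ?mulr0 //.
by rewrite oppr_eq0 gt_eqF // ltr_wpDl.
Qed.

(** For fixed y the product over p < y is a limit, as V grows, of sums over [smooth V y]. For y >= N
    and V > N these contain every positive n < N, so they differ from L by two tails beyond N,
    uniformly in V. *)
Lemma residual_product (E : nat -> R[i]) L :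
  (forall p, prime p -> tends (fun N => \sum_(0 <= v < N) F (p ^ v)%N * q p ^+ v) (E p)) ->
  tends (fun N => \sum_(0 <= n < N) residual_term n) L ->
  tends (fun N => \prod_(0 <= p < N | prime p) ((1 - p%:R^-1) ^+ k * E p)) L.
Proof.
move=> tE tL e e0; have e2 : 0 < e / 2 by lra.
have [|M M0 hM] := @residual_abs_sum R r f k r0 hf (r + 1); first by lra.
have [||N hN] := @bounded_series_tail R (fun n => nrm (residual_term n)) M _ _ _ e2.
- by move=> n; exact: nrm_ge0.
- case=> [|N]; first by rewrite big_geq.
  rewrite big_ltn // residual_term0 nrm0 add0r; apply: le_trans (hM N.+1).
  by apply: ler_sum => n _; rewrite nrm_residual_term.
exists N => y Ny.
have LN : nrm (L - \sum_(0 <= n < N) residual_term n) <= e / 2.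
  apply: (tends_bound tL); exists N => n Nn.
  rewrite (big_cat_nat _ Nn) //= addrAC subrr add0r.
  apply: le_trans (ler_nrm_sum _ _ _) _; apply: hN; first exact: iota_uniq.
  by move=> i; rewrite mem_index_iota => /andP[].
have tP : tends (fun V => \prod_(0 <= p < y | prime p) \sum_(0 <= v < V) residual_term (p ^ v)%N)
    (\prod_(0 <= p < y | prime p) ((1 - p%:R^-1) ^+ k * E p)).
  apply: tends_prod => p pp; under eq_fun do under eq_bigr do rewrite residual_term_pfactor.
  by apply: residual_series => //; exact: tE.
apply: (tends_bound tP); exists N.+1 => V NV.
rewrite (prod_sum_smooth _ _ residual_term_mult).
rewrite (bigID (fun n => (n < N)%N)) /=.
have -> : \sum_(n <- smooth V y | (n < N)%N) residual_term n = \sum_(0 <= n < N) residual_term n.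
  have -> : \sum_(0 <= n < N) residual_term n = \sum_(1 <= n < N) residual_term n.
    case: (N) => [|N']; first by rewrite !big_geq.
    by rewrite big_ltn // residual_term0 add0r.
  rewrite -[LHS]big_filter; apply: perm_big; apply: uniq_perm.
  - by rewrite filter_uniq // smooth_uniq.
  - exact: iota_uniq.
  move=> n; rewrite mem_filter mem_index_iota andbC; case: ltnP => nN; rewrite ?andbF // !andbT.
  apply/idP/idP => [/smooth_lt[] //|n0]; apply: mem_smooth => // [|p pp pn].
    exact: leq_ltn_trans NV.
  split; first exact: leq_ltn_trans (dvdn_leq n0 pn) (leq_trans nN Ny).
  apply: leq_ltn_trans NV; apply: leq_trans (ltnW nN).
  apply: leq_trans (dvdn_leq n0 (pfactor_dvdnn p n)).
  by rewrite ltnW // ltn_expl // prime_gt1.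
set S1 := \sum_(0 <= n < N) _ in LN *; set S2 := \sum_(n <- _ | _) _.
have h2 : nrm S2 <= e / 2.
  apply: le_trans (ler_nrm_sum _ _ _) _; rewrite -big_filter; apply: hN.
    by rewrite filter_uniq // smooth_uniq.
  by move=> n; rewrite mem_filter -leqNgt => /andP[].
have -> : S1 + S2 - L = (S1 - L) + S2 by ring.
apply: le_trans (ler_nrmD _ _) _; rewrite nrmB; lra.
Qed.
End EulerConstant.

(** * The main term *)

Section MainTerm.
Variables (R : realType) (r : R) (f : nat -> R[i]) (k : nat).
Hypothesis r0 : 0 <= r.
Hypothesis hf : class_A r f.
Local Notation F := (lcm_fun f k).
Local Notation g := (residual r f k).
Local Notation u := (residual_term r f k).

Lemma lcm_sumE (x : R) : 0 <= x ->
  lcm_sum f k x = \sum_(1 <= n < (Num.truncn x).+1) F n.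
Proof.
move=> x0; have /andP[Nx xN] := truncn_itv x0.
rewrite /lcm_sum; set N := Num.truncn x in Nx xN *.
have E (t : {ffun 'I_k -> 'I_N.+1}) :
   [forall i, (0 < t i)%N] && ((\prod_(i < k) t i)%N%:R <= x)
   = (0 < \prod_(i < k) t i <= N)%N.
  congr (_ && _).
    apply/forallP/idP => [h|h i]; first exact: prodn_gt0.
    by rewrite lt0n; apply: contraTneq h => h; rewrite (bigD1 i) //= h mul0n.
  apply/idP/idP => h.
    by rewrite -ltnS -(ltr_nat R); apply: le_lt_trans xN.
  by apply: le_trans Nx; rewrite ler_nat.
rewrite (eq_bigl _ _ E) big_add1 /= big_mkord.
transitivity (\sum_(m < N) \sum_(t : {ffun 'I_k -> 'I_N.+1} | (\prod_(i < k) t i)%N == m.+1)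
    f (lcmn 1 (\big[lcmn/1%N]_(i < k) t i))); last first.
  by apply: eq_bigr => m _; rewrite lcm_convE // ltn_ord.
rewrite (exchange_big_dep (fun t : {ffun 'I_k -> 'I_N.+1} => (0 < \prod_(i < k) t i <= N)%N)) /=; last first.
  by move=> m t _ /eqP ->; rewrite /= ltn_ord.
apply: eq_bigr => t /andP[t0 tN].
have tN' : ((\prod_(i < k) t i).-1 < N)%N by rewrite prednK.
rewrite (eq_bigl (fun m => m == Ordinal tN')); last first.
  by move=> m; rewrite /= -val_eqE /= -[in LHS](prednK t0) eqSS eq_sym.
by rewrite big_pred1_eq lcm1n.
Qed.

Lemma lcm_sum_twisted (x : R) : 0 <= x ->
  lcm_sum f k x = \sum_(1 <= d < (Num.truncn x).+1)
    g d * (twisted_Tsum k r (Num.truncn (x / d%:R)))%:C.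
Proof.
move=> x0; rewrite lcm_sumE //; set N := Num.truncn x.
transitivity (\sum_(1 <= n < N.+1) \sum_(d <- divisors n)
    g d * ((tau k (n %/ d))%:R * power_fun r (n %/ d)%N)).
  by apply: eq_big_nat => n /andP[n0 _]; rewrite (lcm_fun_residual k hf).
rewrite (sum_big_divisors N (fun d m => g d * ((tau k m)%:R * power_fun r m))).
apply: eq_big_nat => d /andP[d0 _]; rewrite -big_distrr /= truncn_divn //.
congr (_ * _); rewrite /twisted_Tsum rmorph_sum /=; apply: eq_bigr => m _.
by rewrite rmorphM rmorph_nat.
Qed.

(** The logarithms cost at most a factor n^(1/4), leaving the exponent r + 3/4 > r + 1/2. Moment 0
    turns out to be C; the moments together give the coefficients of Q. *)
Lemma log_moment_exists m : exists l : R[i],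
  tends (fun N => \sum_(0 <= n < N) u n * ((- ln n%:R) ^+ m)%:C) l.
Proof.
have e4 : 0 < (1 / 4 : R) by lra.
have [K K0 hK] := horner_ln_bound ('X^m) e4.
have [|M M0 hM] := @residual_abs_sum R r f k r0 hf (r + 3 / 4); first by lra.
apply: (@abs_series_tends _ _ (K * M)) => -[|N]; first by rewrite big_geq ?mulr_ge0.
rewrite big_ltn // residual_term0 // mul0r nrm0 add0r.
apply: le_trans (ler_wpM2l K0 (hM N.+1)); rewrite big_distrr /=.
apply: ler_sum_nat => n /andP[n1 _].
have n1R : (1 : R) <= n%:R by rewrite ler1n.
have n0R : (0 : R) < n%:R by lra.
rewrite nrmM nrm_residual_term nrmC normrX normrN -normrX.
have := hK _ n1R; rewrite hornerXn => h.
have -> : n%:R `^ (- (r + 3 / 4)) = n%:R `^ (- (r + 1)) * n%:R `^ (1 / 4) :> R.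
  by rewrite -powRD ?(gt_eqF n0R) ?implybT //; congr (_ `^ _); lra.
rewrite mulrCA -mulrA ler_wpM2l ?nrm_ge0 // mulrCA ler_wpM2l ?powR_ge0 //.
Qed.

(** Binomial expansion of B(t - ln n) in powers of t, with the sum over n carried out
    coefficientwise. For j < i the binomial coefficient vanishes, so the truncated j - i does no
    harm. *)
Lemma main_poly_tends (B : {poly R}) (L : nat -> R[i]) (t : R) : (size B <= k)%N ->
  (forall m, tends (fun N => \sum_(0 <= n < N) u n * ((- ln n%:R) ^+ m)%:C) (L m)) ->
  tends (fun N => \sum_(0 <= n < N) u n * (B.[t - ln n%:R])%:C)
    (\poly_(i < k) \sum_(j < k) (B`_j *+ 'C(j, i))%:C * L (j - i)%N).[t%:C].
Proof.
move=> sB hL.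
have BE n : (B.[t - ln n%:R])%:C = \sum_(i < k) \sum_(j < k)
    (B`_j *+ 'C(j, i))%:C * ((- ln n%:R) ^+ (j - i))%:C * t%:C ^+ i :> R[i].
  rewrite (horner_coef_wide _ sB) exchange_big rmorph_sum /=; apply: eq_bigr => j _.
  rewrite addrC exprDn big_distrr /= (big_ord_widen k
    (fun i => B`_j * ((- ln n%:R) ^+ (j - i) * t ^+ i *+ 'C(j, i)))) // rmorph_sum.
  rewrite big_mkcond; apply: eq_bigr => i _; rewrite ltnS -rmorphXn -!rmorphM.
  case: leqP => ij; last by rewrite bin_small // mulr0n !mul0r.
  by congr (_%:C); rewrite mulrnAr !mulrnAl mulrA.
rewrite horner_poly.
have E N : \sum_(0 <= n < N) u n * (B.[t - ln n%:R])%:C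
  = \sum_(i < k) (\sum_(j < k) (B`_j *+ 'C(j, i))%:C *
      (\sum_(0 <= n < N) u n * ((- ln n%:R) ^+ (j - i))%:C)) * t%:C ^+ i.
  under eq_bigr => n _ do rewrite BE big_distrr /=.
  rewrite exchange_big; apply: eq_bigr => i _ /=.
  under eq_bigr => n _ do rewrite big_distrr /=.
  rewrite exchange_big big_distrl; apply: eq_bigr => j _ /=.
  rewrite big_distrr big_distrl; apply: eq_bigr => n _ /=.
  by ring.
under eq_fun do rewrite E.
apply: tends_sum => i _; apply: tendsM; last exact: tends_cst.
by apply: tends_sum => j _; apply: tendsM; [exact: tends_cst | exact: hL].
Qed.

(** Two errors add up: those of the twisted sums at x/d for d <= x, summable because s > 1/2, and
    the tail d > x of the series for Q(ln x). *)
Lemma lcm_sum_error (B : {poly R}) (L : nat -> R[i]) (s K : R) : (size B <= k)%N ->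
  (forall m, tends (fun N => \sum_(0 <= n < N) u n * ((- ln n%:R) ^+ m)%:C) (L m)) ->
  1 / 2 < s -> 0 <= K ->
  (forall y, 1 <= y ->
    `|twisted_Tsum k r (Num.truncn y) - y `^ (r + 1) * B.[ln y]| <= K * y `^ (r + s)) ->
  exists K', forall x, 1 <= x ->
    nrm (lcm_sum f k x - (x `^ (r + 1))%:C
      * (\poly_(i < k) \sum_(j < k) (B`_j *+ 'C(j, i))%:C * L (j - i)%N).[(ln x)%:C])
    <= K' * x `^ (r + s).
Proof.
move=> sB hL s2 K0 hB; set Q := \poly_(i < k) _.
have [|M1 M10 hM1] := @residual_abs_sum R r f k r0 hf (r + s); first by lra.
(* g is summable at exponent r + 1 - eta = r + 1/2 + e, so the tail gains x^(-eta). The bound e <= s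
   - 1/2 gives x^(r+1-eta) <= x^(r+s), and e <= 1/4 keeps [eta] positive. *)
pose e := Num.min (s - 1 / 2) (1 / 4); pose eta := 1 / 2 - e.
have e0 : 0 < e by rewrite lt_min; apply/andP; split; lra.
have es : e <= s - 1 / 2 by rewrite ge_min lexx.
have e4 : e <= 1 / 4 by rewrite ge_min lexx orbT.
have eta0 : 0 < eta by rewrite /eta; lra.
have [|M2 M20 hM2] := @residual_abs_sum R r f k r0 hf (r + 1 - eta); first by rewrite /eta; lra.
(* In the tail the argument ln x - ln d is negative, so B(-u) is bounded at u = ln(d/x), by a
   multiple of (d/x)^eta. *)
have [K2 K20 hK2] := horner_expR_bound (B \Po (- 'X)) eta0.
exists (K * M1 + K2 * M2) => x x1; have x0 : 0 < x by lra.
have /andP[Nx xN] := truncn_itv (ltW x0).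
rewrite lcm_sum_twisted ?(ltW x0) //; set N := Num.truncn x in Nx xN *.
have dx d : (1 <= d < N.+1)%N -> (0 : R) < d%:R /\ 1 <= x / d%:R.
  move=> /andP[d1 dN]; have d0 : (0 : R) < d%:R by rewrite ltr0n.
  by split=> //; rewrite ler_pdivlMr // mul1r (le_trans _ Nx) // ler_nat -ltnS.
pose S := \sum_(0 <= d < N.+1) u d * (B.[ln x - ln d%:R])%:C.
have main : \sum_(1 <= d < N.+1) g d * ((x / d%:R) `^ (r + 1) * B.[ln (x / d%:R)])%:C
   = (x `^ (r + 1))%:C * S.
  rewrite /S [in RHS]big_ltn // residual_term0 // mul0r add0r big_distrr /=.
  apply: eq_big_nat => d /dx[d0 xd]; rewrite ln_div ?posrE //.
  rewrite powRM ?(ltW x0) ?invr_ge0 ?(ltW d0) // -powR_inv1 ?(ltW d0) // -powRrM mulN1r.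
  by rewrite /residual_term !rmorphM /=; ring.
have -> : \sum_(1 <= d < N.+1) g d * (twisted_Tsum k r (Num.truncn (x / d%:R)))%:C
    - (x `^ (r + 1))%:C * Q.[(ln x)%:C]
  = \sum_(1 <= d < N.+1) g d * (twisted_Tsum k r (Num.truncn (x / d%:R))
        - (x / d%:R) `^ (r + 1) * B.[ln (x / d%:R)])%:C
    - (x `^ (r + 1))%:C * (Q.[(ln x)%:C] - S).
  under [X in _ = X - _]eq_bigr => d _ do rewrite rmorphB mulrBr.
  by rewrite sumrB main mulrBr; ring.
apply: le_trans (ler_nrmB _ _) _; rewrite mulrDl; apply: lerD.
  apply: le_trans (ler_nrm_sum _ _ _) _.
  rewrite mulrAC; apply: le_trans (ler_wpM2l _ (hM1 N.+1)); last by rewrite mulr_ge0 ?powR_ge0.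
  rewrite big_distrr /=; apply: ler_sum_nat => d /dx[d0 xd].
  rewrite nrmM nrmC mulrCA ler_wpM2l ?nrm_ge0 //.
  apply: le_trans (hB _ xd) _; rewrite -mulrA ler_wpM2l //.
  rewrite powRM ?(ltW x0) ?invr_ge0 ?(ltW d0) // -powR_inv1 ?(ltW d0) // -powRrM mulN1r.
  exact: lexx.
rewrite nrmM nrmC ger0_norm ?powR_ge0 //.
have SQ : nrm (Q.[(ln x)%:C] - S) <= K2 * x `^ (- eta) * M2.
  apply: (tends_bound (main_poly_tends (ln x) sB hL)); exists N.+1 => n Nn.
  rewrite (big_cat_nat _ Nn) //= addrAC subrr add0r.
  apply: le_trans (ler_nrm_sum _ _ _) _.
  apply: le_trans (_ : _ <= K2 * x `^ (- eta) *
     \sum_(N.+1 <= d < n) nrm (g d) * d%:R `^ (- (r + 1 - eta))) _; last first.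
    apply: ler_wpM2l; first by rewrite mulr_ge0 ?powR_ge0.
    apply: le_trans (hM2 n); rewrite [leRHS](@big_cat_nat _ _ _ N.+1) //= lerDr.
    by apply: sumr_ge0 => d _; rewrite mulr_ge0 ?nrm_ge0 ?powR_ge0.
  rewrite big_distrr /=; apply: ler_sum_nat => d /andP[Nd _].
  have xd : x <= d%:R by apply: le_trans (ltW xN) _; rewrite ler_nat.
  have d0 : (0 : R) < d%:R by lra.
  rewrite nrmM nrm_residual_term nrmC.
  have ld : 0 <= ln d%:R - ln x by rewrite subr_ge0 ler_ln ?posrE.
  have := hK2 _ ld; rewrite horner_comp !hornerE opprB => h.
  have -> : d%:R `^ (- (r + 1 - eta)) = d%:R `^ (- (r + 1)) * d%:R `^ eta :> R.
    by rewrite -powRD ?(gt_eqF d0) ?implybT //; congr (_ `^ _); lra.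
  have hE : expR (eta * (ln d%:R - ln x)) = x `^ (- eta) * d%:R `^ eta.
    by rewrite !powRE // -expRD; congr expR; lra.
  rewrite [leRHS](_ : _ = nrm (g d) * d%:R `^ (- (r + 1)) * (K2 * (x `^ (- eta) * d%:R `^ eta))).
    by rewrite ler_wpM2l ?mulr_ge0 ?nrm_ge0 ?powR_ge0 // -hE.
  by rewrite /=; ring.
apply: le_trans (ler_wpM2l (powR_ge0 _ _) SQ) _.
have -> : x `^ (r + 1) * (K2 * x `^ (- eta) * M2) = K2 * M2 * (x `^ (r + 1) * x `^ (- eta)) by ring.
rewrite ler_wpM2l ?mulr_ge0 // -powRD ?(gt_eqF x0) ?implybT //.
by rewrite ler_powR // /eta; lra.
Qed.
End MainTerm.

Theorem theorem2p5 (R : realType) (k : nat) (hk : (2 <= k)%N)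
    (r : R) (hr : 0 <= r) (f : nat -> R[i]) (hf : class_A r f)
    (Z : R[i] -> R[i]) (hZ : is_riemann_zeta Z)
    (P : {poly R}) (hP : is_piltz_poly Z k P) :
  exists (C : R[i]) (Q : {poly R[i]}),
    [/\ is_euler_const f r k C,
        (size Q <= k)%N,
        Q`_k.-1 = (((r + 1) * (k.-1)`!%:R)^-1)%:C * C &
        forall theta : R, 1 / 2 <= theta ->
          (forall eps : R, 0 < eps ->
             exists K : R, \forall x \near +oo,
               `|tau_sum k x - x * P.[ln x]| <= K * x `^ (theta + eps)) ->
          forall eps : R, 0 < eps ->
            exists K : R, \forall x \near +oo,
              `|lcm_sum f k x - (x `^ (r + 1))%:C * Q.[(ln x)%:C]|
                <= (K * x `^ (r + theta + eps))%:C].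
Proof.
have [A [sA cA hA]] := piltz_main P hk.
have k0 : (0 < k)%N := ltnW hk.
have sA' : (size (A + A^`())%R <= k)%N.
  apply: leq_trans (size_polyD _ _) _; rewrite geq_max sA.
  exact: leq_trans (size_poly _ _) (leq_trans (leq_pred _) sA).
(* The derivative does not reach degree k - 1, so [B] has top coefficient 1/((r+1)(k-1)!). *)
have [B [sB BA cB]] := exists_twisted_poly hr sA'.
have [L hL] := choice (log_moment_exists k hr hf).
have cBk : B`_k.-1 = ((r + 1) * (k.-1)`!%:R)^-1.
  rewrite cB coefD coef_deriv prednK // [A`_k]nth_default // mul0rn addr0 cA.
  by rewrite invfM mulrC.
have tL0 : tends (fun N => \sum_(0 <= n < N) residual_term r f k n) (L 0%N).
  have := hL 0%N; under eq_fun do under eq_bigr do rewrite expr0 mulr1.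
  exact.
exists (L 0%N), (\poly_(i < k) \sum_(j < k) (B`_j *+ 'C(j, i))%:C * L (j - i)%N); split.
- have Eex p : exists Ep, prime p -> tends
      (fun N => \sum_(0 <= v < N) lcm_fun f k (p ^ v)%N * local_ratio r p ^+ v) Ep.
    case pp: (prime p); last by exists 0.
    by have [Ep hEp] := euler_factor_exists k hr hf pp; exists Ep.
  have [E hE] := choice Eex.
  exists E; split; first by move=> p pp; apply: csum_to_lcm_fun => //; exact: hE.
  by apply: tends_ccvg; exact: (residual_product hr hf hE tL0).
- exact: size_poly.
(* In degree k - 1 only j = k - 1 survives, with moment 0, which is the value of the Euler
   product. *)
- rewrite coef_poly prednK // leqnn (bigD1 (Ordinal (eq_leq (prednK k0)))) //=.
  rewrite binn mulr1n subnn cBk big1 ?addr0 // => j jk.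
  rewrite bin_small ?mulr0n ?mul0r //.
  have := ltn_ord j; rewrite -{2}(prednK k0) ltnS leq_eqVlt => /orP[/eqP e|//].
  by move: jk; rewrite -val_eqE /= e eqxx.
- move=> theta th2 hth eps eps0.
  have [K1 K10 hK1] := hA _ th2 hth _ eps0.
  (* With s = theta + eps the inequality s > 1/2 is strict even for theta = 1/2, as the convergence
     of the sums over g requires. *)
  have s0 : 0 < theta + eps by lra.
  have [K2 K20 hK2] := twisted_Tsum_asymp hr s0 K10 BA hK1.
  have [|K hK] := lcm_sum_error hr hf sB hL _ K20 hK2; first by lra.
  exists K; near=> x.
  rewrite normcE lecR -addrA; apply: hK; near: x; exact: nbhs_pinfty_ge.
Unshelve. all: by end_near.
Qed.
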